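(* Let $q\geqslant 2$ be an integer, let $T$ be the homogeneous tree of degree $q$ and let $P$ be its isotropic nearest neighbor transition operator. For $\lambda\in\mathbb{C}\setminus\mathsf{spec}(P)$, the operator $P-\lambda\mathbb{I}$ is not hypercyclic on the Banach space $Y_\lambda$.
   Context: The homogeneous tree $T$ of degree $q\geqslant 2$ is the connected graph without loops (cycles) in which every vertex has exactly $q+1$ neighbors; $T$ also denotes its vertex set, $o$ is a fixed root vertex, $|x|=\mathrm{dist}(x,o)$, and $x\sim y$ means $x,y$ are adjacent. $P$ acts on functions $f:T\to\mathbb{C}$ by $Pf(x)=\frac1{q+1}\sum_{y\sim x}f(y)$; $\mathbb{I}$ is the identity. $\mathsf{spec}(P)$ is the spectrum of $P$ on $\ell^2(T)$, namely $[-\rho,\rho]$ with $\rho=2\sqrt q/(q+1)$. Boundary: $\partial T$ is the set of infinite geodesic paths starting at $o$, with the topology generated by the sets of paths passing through a given vertex. For $x\in T$, $\xi\in\partial T$, $x\wedge\xi$ is the last common vertex of the geodesic from $o$ to $x$ and the path $\xi$, and $\mathfrak{h}(x,\xi)=2|x\wedge\xi|-|x|$. A distribution on $\partial T$ is a finitely additive complex measure on the algebra of clopen subsets of $\partial T$; $\|\sigma\|\in[0,\infty]$ is its total variation (the measure norm), and distributions with $\|\sigma\|<\infty$ are the finite complex Borel measures. Generalized Poisson kernel: for $\lambda\in\mathbb{C}\setminus[-\rho,\rho]$ let $z=z(\lambda)$ with $\mathrm{Re}\,z>\frac12$, $|\mathrm{Im}\,z|\leqslant \pi/\ln q$ and $\lambda=(q^z+q^{1-z})/(q+1)$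 (so $q^z$ is uniquely determined by $\lambda$), and $K(x,\xi|\lambda)=q^{z\,\mathfrak{h}(x,\xi)}$. Let $K^{(r)}(x,\xi|\lambda)=\frac{\partial^r}{\partial\lambda^r}K(x,\xi|\lambda)$ and, for a distribution $\sigma$, $\boldsymbol{K}_\lambda^{(r)}(\sigma)(x)=\int_{\partial T}K^{(r)}(x,\xi|\lambda)\,d\sigma(\xi)$. A function $f$ on $T$ is $\lambda$-polyharmonic if $(P-\lambda\mathbb{I})^nf=0$ for some $n$. It is known that every $\lambda$-polyharmonic function is uniquely of the form $f=\sum_{j=0}^{m}\boldsymbol{K}_\lambda^{(j)}(\sigma_j)$ with distributions $\sigma_j$; put $|||f|||=\sum_{j=0}^{m}j!\,\|\sigma_j\|$. $\mathcal{H}_\lambda$ is the space of $\lambda$-polyharmonic functions $f$ with $|||f|||<\infty$ (all $\sigma_j$ finite measures). $Y_\lambda$ is the closure (completion) of $\mathcal{H}_\lambda$ in the norm $|||\cdot|||$, its elements being regarded as functions on $T$ by identifying a norm-Cauchy sequence with its pointwise limit. The operator $P-\lambda\mathbb{I}$ acts as a bounded operator on $Y_\lambda$. An operator $U$ on a Banach space $Y$ is hypercyclic if there is $f\in Y$ such that $\{U^nf: n\in\mathbb{N}\}$ is dense in $Y$. *)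

(* Defs.v *)
From HB Require Import structures.
From mathcomp Require Import all_boot all_order all_algebra.
From mathcomp Require Import all_classical all_reals all_analysis.
From mathcomp Require Import complex.

Set Implicit Arguments.
Unset Strict Implicit.
Unset Printing Implicit Defensive.

Import Order.TTheory GRing.Theory Num.Theory.
Import numFieldNormedType.Exports.

Local Open Scope classical_set_scope.
Local Open Scope card_scope.
Local Open Scope ring_scope.
Local Open Scope complex_scope.

Record homogeneous_tree (q : nat) (T : choiceType) (e : rel T) : Prop := {
  tree_sym : symmetric e ;
  tree_irrefl : irreflexive e ;
  tree_connected : forall x y, exists2 p, path e x p & last x p = y ;
  tree_acyclic : forall c, (2 < size c)%N -> ~ ucycle e c ;
  tree_degree : forall x, [set y | e x y] #= `I_q.+1 }.

Section Tree.
Context {T : choiceType} (e : rel T) (o : T).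

Definition walk (x y : T) (n : nat) : Prop :=
  exists p, [/\ path e x p, last x p = y & size p = n].

Definition dist (x y : T) : nat :=
  xget 0%N [set n | walk x y n /\ forall m, walk x y m -> (n <= m)%N].

Definition level (x : T) : nat := dist x o.

Definition geodesic_seg (x y : T) : set T :=
  [set v | (dist x v + dist v y = dist x y)%N].

Definition is_ray (xi : nat -> T) : Prop :=
  xi 0%N = o /\ forall m n, (m <= n)%N -> dist (xi m) (xi n) = (n - m)%N.

Definition boundary : Type := {xi : nat -> T | is_ray xi}.

Definition vertices (xi : boundary) : set T := range (sval xi).

Definition boundary_arc (x : T) : set boundary := [set xi | vertices xi x].

Definition confluent (x : T) (xi : boundary) : T :=
  xget o [set v | (geodesic_seg o x `&` vertices xi) v /\
    forall w, (geodesic_seg o x `&` vertices xi) w -> (level w <= level v)%N].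

Definition horocycle (x : T) (xi : boundary) : int :=
  (2 * level (confluent x xi))%:Z - (level x)%:Z.

End Tree.

HB.instance Definition _ (T : choiceType) (e : rel T) (o : T) :=
  gen_eqMixin (boundary e o).
HB.instance Definition _ (T : choiceType) (e : rel T) (o : T) :=
  gen_choiceMixin (boundary e o).
HB.instance Definition _ (T : choiceType) (e : rel T) (o : T) :=
  @isSubBaseTopological.Build (boundary e o) (set (boundary e o))
    (range (@boundary_arc T e o)) id.

Section Distributions.
Context {R : realType} {T : choiceType} {e : rel T} {o : T}.
Notation bd := (boundary e o).

(* Only the values of [sigma] on clopen sets are meaningful. Taking
   [A = B = set0] gives [sigma set0 = 0]. *)
Definition is_distribution (sigma : set bd -> R[i]) : Prop :=
  forall A B, clopen A -> clopen B -> A `&` B = set0 ->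
    sigma (A `|` B) = sigma A + sigma B.

Definition total_variation (sigma : set bd -> R[i]) : \bar R :=
  ereal_sup [set r | exists n (A : 'I_n -> set bd),
    [/\ forall i, clopen (A i), trivIset setT A, \bigcup_i A i = setT &
        r = (\sum_(i < n) complex.Re `|sigma (A i)|)%:E]].

(* Integral of a locally constant (hence finitely valued) function: this is
   the only kind of integrand a finitely additive measure is applied to. *)
Definition dist_integral (sigma : set bd -> R[i]) (g : bd -> R[i]) : R[i] :=
  \sum_(c \in range g) c * sigma (g @^-1` [set c]).

End Distributions.

Section Polyharmonic.
Context {R : realType} (q : nat) {T : choiceType} (e : rel T) (o : T).

Definition transition (f : T -> R[i]) (x : T) : R[i] :=
  (q.+1)%:R^-1 * \sum_(y \in [set y | e x y]) f y.

Definition shifted (lambda : R[i]) (f : T -> R[i]) : T -> R[i] :=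
  fun x => transition f x - lambda * f x.

Definition l2norm_sq (f : T -> R[i]) : \bar R :=
  \esum_(x in [set: T]) ((complex.Re `|f x|) ^+ 2)%:E.

Definition l2 : set (T -> R[i]) := [set f | (l2norm_sq f < +oo)%E].

(* [lambda] is in the resolvent set when [P - lambda] has a bounded two-sided
   inverse [S] on l^2; norms are squared, so [M] is a squared operator bound. *)
Definition spec : set R[i] := [set lambda |
  ~ exists S : (T -> R[i]) -> (T -> R[i]),
    [/\ forall g, l2 g -> l2 (S g),
        forall g, l2 g -> shifted lambda (S g) = g,
        forall f, l2 f -> S (shifted lambda f) = f &
        exists M : R, forall g, l2 g ->
          (l2norm_sq (S g) <= M%:E * l2norm_sq g)%E]].

Definition qpow (z : R[i]) : R[i] :=
  let l : R := ln q%:R in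
  (expR (complex.Re z * l) * cos (complex.Im z * l)) +i*
  (expR (complex.Re z * l) * sin (complex.Im z * l)).

(* If [|Im z| = pi / ln q] both signs are admissible; [qpow z], and hence the
   kernel below, does not depend on the choice. For [lambda] in [spec] no such
   [z] exists and the value is a dummy. *)
Definition zeta (lambda : R[i]) : R[i] :=
  xget 0 [set z | [/\ 2^-1 < complex.Re z, `|complex.Im z| <= pi / ln q%:R &
    lambda = (qpow z + qpow (1 - z)) / (q.+1)%:R]].

Definition poisson_kernel (x : T) (xi : boundary e o) (lambda : R[i]) : R[i] :=
  qpow (zeta lambda * (horocycle x xi)%:~R).

Definition poisson_kernel_n (r : nat) (x : T) (xi : boundary e o)
    (lambda : R[i]) : R[i] :=
  derive1n r (poisson_kernel x xi : R[i] -> R[i]^o) lambda.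

Definition poisson_transform (lambda : R[i]) (r : nat)
    (sigma : set (boundary e o) -> R[i]) (x : T) : R[i] :=
  dist_integral sigma (fun xi => poisson_kernel_n r x xi lambda).

Definition polyharmonic (lambda : R[i]) (f : T -> R[i]) : Prop :=
  exists n, iter n (shifted lambda) f = cst 0.

Definition represents (lambda : R[i]) (f : T -> R[i]) (m : nat)
    (sigma : 'I_m.+1 -> set (boundary e o) -> R[i]) : Prop :=
  (forall j, is_distribution (sigma j)) /\
  f = fun x => \sum_(j < m.+1) poisson_transform lambda j (sigma j) x.

(* The value is determined by [f]: the distributions representing a
   polyharmonic function are unique. *)
Definition poly_norm (lambda : R[i]) (f : T -> R[i]) : \bar R :=
  xget +oo%E [set r | exists m (sigma : 'I_m.+1 -> set (boundary e o) -> R[i]),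
    represents lambda f sigma /\
    r = (\sum_(j < m.+1) (j`!)%:R%:E * total_variation (sigma j))%E].

Definition polyharm_space (lambda : R[i]) : set (T -> R[i]) :=
  [set f | polyharmonic lambda f /\ (poly_norm lambda f < +oo)%E].

End Polyharmonic.

(* [(Y, iota)] is a completion of the linear space [H] of functions under the
   norm [N]. Only the values of [iota] on [H] matter. *)
Definition is_completion {R : realType} {T : choiceType}
    (H : set (T -> R[i])) (N : (T -> R[i]) -> \bar R)
    (Y : completeNormedModType R[i]) (iota : (T -> R[i]) -> Y) : Prop :=
  [/\ forall (a : R[i]) f g, H f -> H g ->
        iota (fun x => a * f x + g x) = a *: iota f + iota g,
      forall f, H f -> `|iota f| = (fine (N f))%:C &
      dense (iota @` H)].

Definition hypercyclic {K : numFieldType} {Y : normedModType K} (U : Y -> Y) :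
    Prop :=
  exists f, dense [set iter n U f | n in [set: nat]].

(* Main.v *)
Require Import Defs.
From HB Require Import structures.
From mathcomp Require Import all_boot all_order all_algebra.
From mathcomp Require Import all_classical all_reals all_analysis.
From mathcomp Require Import complex.
From mathcomp Require Import finmap zify ring lra.

Set Implicit Arguments.
Unset Strict Implicit.
Unset Printing Implicit Defensive.

Import Order.TTheory GRing.Theory Num.Theory.
Import numFieldNormedType.Exports.

Local Open Scope classical_set_scope.
Local Open Scope ring_scope.
Local Open Scope complex_scope.

(**
Write [K^(r)] for the [r]-th derivative in [lambda] of the Poisson kernel.
Differentiating [P K = lambda K] gives [(P - lambda) K^(r) = r K^(r-1)], so on
the coefficients of [f = sum_j K^(j)(sigma_j)] the operator [P - lambda] is the
weighted backward shift [sigma_j |-> j sigma_j], placed in degree [j - 1]. With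
the weights [j!] this is a contraction, so every orbit of its extension to the
completion is bounded, and a bounded set is not dense in a nonzero space.

The norm is well defined because the [sigma_j] are determined by [f] on clopen
sets: applying [P - lambda] repeatedly reduces this to the injectivity of
[sigma |-> K(sigma)], which follows from
[K(x, .) - q^(-z) K(x^-, .) = q^(z|x|) (1 - q^(-2z)) 1_{arc x}], with [x^-] the
parent of [x].

All this needs [lambda] off the segment [[-rho, rho]]. If [lambda] lies on it
and [f] in l^2 solves [(P - lambda) f = delta_o], the sums of [f] over spheres
satisfy a second order recurrence with an invariant quadratic form, which
contradicts their decay.
*)

(** * Rooted tree combinatorics *)

Section TreeDistance.
Variables (q : nat) (T : choiceType) (e : rel T).
Hypothesis hT : homogeneous_tree q e.

(** Connectedness provides a walk, so the set in [dist] contains a least length and [xget] never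
    falls back on its default 0. *)
Lemma walk_dist x y : walk e x y (dist e x y).
Proof.
have hex : exists n, `[< walk e x y n >].
  by have [p pp lp] := tree_connected hT x y; exists (size p); apply/asboolP; exists p.
rewrite /dist; case: xgetP => [n -> [] //|/(_ (ex_minn hex)) []].
case: ex_minnP => n /asboolP wn nmin; split=> // m /asboolP; exact: nmin.
Qed.

Lemma dist_le_walk x y n : walk e x y n -> (dist e x y <= n)%N.
Proof.
have hex : exists n, `[< walk e x y n >].
  by have [p pp lp] := tree_connected hT x y; exists (size p); apply/asboolP; exists p.
rewrite /dist; case: xgetP => [m -> [_ mmin]|/(_ (ex_minn hex)) []]; first exact: mmin.
case: ex_minnP => m /asboolP wm mmin; split=> // k /asboolP; exact: mmin.
Qed.

Lemma walk_sym x y n : walk e x y n -> walk e y x n.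
Proof.
move=> [p [pp lp sp]]; exists (rev (belast x p)); split.
- by rewrite -lp rev_path; apply: sub_path pp => a b /=; rewrite (tree_sym hT).
- by case: p {pp sp} lp => [|a p] //= _; rewrite rev_cons last_rcons.
- by rewrite size_rev size_belast.
Qed.

Lemma distC x y : dist e x y = dist e y x.
Proof.
by apply/eqP; rewrite eqn_leq !dist_le_walk //; apply: walk_sym; exact: walk_dist.
Qed.

Lemma dist_triangle y x z : (dist e x z <= dist e x y + dist e y z)%N.
Proof.
have [p [pp lp <-]] := walk_dist x y; have [r [pr lr <-]] := walk_dist y z.
apply: dist_le_walk; exists (p ++ r).
by rewrite cat_path pp lp pr last_cat lp lr size_cat.
Qed.

Lemma distxx x : dist e x x = 0%N.
Proof. by apply/eqP; rewrite -leqn0; apply: dist_le_walk; exists [::]. Qed.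

Lemma dist_eq0 x y : dist e x y = 0%N -> x = y.
Proof.
move=> d0; have [p [_ lp]] := walk_dist x y.
by rewrite d0 => /size0nil p0; rewrite -lp p0.
Qed.

Lemma dist_edge x y : e x y -> (dist e x y <= 1)%N.
Proof. by move=> exy; apply: dist_le_walk; exists [:: y]; rewrite /= exy. Qed.

Lemma dist1_edge x y : dist e x y = 1%N -> e x y.
Proof.
move=> d1; have [p [pp lp]] := walk_dist x y; rewrite d1.
by case: p pp lp => [|a [|b p]] //= /andP[exa _] <-.
Qed.

Lemma dist_step x y n : dist e x y = n.+1 -> exists2 z, e x z & dist e z y = n.
Proof.
move=> dn; have [p [pp lp]] := walk_dist x y; rewrite dn.
case: p pp lp => [|a p] //= /andP[exa pp] lp [sp]; exists a => //.
have : (dist e a y <= n)%N by apply: dist_le_walk; exists p.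
have := dist_triangle a x y; have := dist_edge exa; lia.
Qed.

End TreeDistance.

(** * Levels, parents and ancestors with respect to the root *)

Section RootedTree.
Variables (q : nat) (T : choiceType) (e : rel T) (o : T).
Hypothesis hT : homogeneous_tree q e.
Notation lev := (level e o).

Lemma level_root : lev o = 0%N. Proof. exact: distxx hT o. Qed.

Lemma level_eq0 x : lev x = 0%N -> x = o.
Proof. exact: dist_eq0 hT _ _. Qed.

Lemma level_edge x y : e x y -> (lev y <= (lev x).+1)%N.
Proof.
move=> exy; have := dist_triangle hT x y o; rewrite (tree_sym hT) in exy.
by have := dist_edge hT exy; rewrite /level; lia.
Qed.

Lemma exists_lower x : x != o -> exists y, e x y /\ (lev y).+1 = lev x.
Proof.
move=> xo; have : (0 < lev x)%N.
  by rewrite lt0n; apply: contra_neq xo => /level_eq0.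
case lx : (lev x) => [//|n] _; have [z exz dz] := dist_step hT lx.
by exists z; split=> //; rewrite /level dz.
Qed.

(* Two vertices on the same sphere are not joined by a simple path staying
   outside the ball: closing it through the parents would give a cycle. *)
Lemma no_outer_path n a b s :
  path e a (rcons s b) -> uniq (a :: rcons s b) ->
  lev a = n -> lev b = n -> {in s, forall v, (n <= lev v)%N} -> False.
Proof.
elim: n a b s => [|n IHn] a b s pab uab la lb ls.
  move: uab; rewrite (level_eq0 la) (level_eq0 lb) /=.
  by rewrite mem_rcons inE eqxx.
have nl v : v \in a :: rcons s b -> (n < lev v)%N.
  rewrite inE mem_rcons inE => /or3P[/eqP->|/eqP->|/ls //]; lia.
have ao : a != o by apply: contra_eq_neq la => ->; rewrite level_root.
have bo : b != o by apply: contra_eq_neq lb => ->; rewrite level_root.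
have [a' [eaa' la']] := exists_lower ao; have [b' [ebb' lb']] := exists_lower bo.
have a'n : a' \notin a :: rcons s b by apply/negP => /nl; lia.
have b'n : b' \notin a :: rcons s b by apply/negP => /nl; lia.
have ea'a : e a' a by rewrite (tree_sym hT).
(* If the parents coincide they close the path to a cycle. Otherwise they extend it at both ends to
   a path of the same kind one level lower. *)
have [ab|ab] := eqVneq a' b'.
  apply: (tree_acyclic hT (c := a' :: a :: rcons s b)).
    by rewrite /= size_rcons.
  rewrite /ucycle; apply/andP; split; last by rewrite cons_uniq a'n.
  by rewrite /= ea'a rcons_path pab last_rcons ab ebb'.
apply: (IHn a' b' (a :: rcons s b)); try lia.
- by rewrite rcons_cons /= ea'a rcons_path pab last_rcons.
- by rewrite cons_uniq rcons_uniq b'n uab andbT mem_rcons in_cons negb_or ab a'n.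
- by move=> v /nl; lia.
Qed.

(** An edge inside a sphere is the shortest path excluded by [no_outer_path], the one without
    interior vertices. *)
Lemma level_edge_neq x y : e x y -> lev x != lev y.
Proof.
move=> exy; apply/eqP => lxy.
apply: (@no_outer_path (lev x) x y [::]) => //=; first by rewrite exy.
rewrite inE andbT; apply/eqP => xy; move: exy.
by rewrite xy (tree_irrefl hT).
Qed.

(** Distinct lower neighbours [y] and [z] would be joined through [x], against [no_outer_path]. *)
Lemma lower_unique x y z : e x y -> e x z ->
  (lev y).+1 = lev x -> (lev z).+1 = lev x -> y = z.
Proof.
move=> exy exz ly lz; apply/eqP/negP => /negP yz.
apply: (@no_outer_path (lev y) y z [:: x]) => //=.
- by rewrite (tree_sym hT) exy exz.
- have [yx xz] : y != x /\ x != z.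
    by split; apply/eqP => E; move: ly lz; rewrite E; lia.
  by rewrite !inE negb_or yz yx xz.
- by move: ly lz; lia.
- by move=> v; rewrite inE => /eqP ->; move: ly; lia.
Qed.

Definition parent (x : T) : T := xget o [set y | e x y /\ (lev y).+1 = lev x].

Lemma parent_root : parent o = o.
Proof. by rewrite /parent; case: xgetP => // y _ [_]; rewrite level_root. Qed.

Lemma parentP x : x != o -> e x (parent x) /\ (lev (parent x)).+1 = lev x.
Proof.
move=> /exists_lower [y hy]; rewrite /parent.
by case: xgetP => [z _ //|/(_ y)].
Qed.

Lemma level_parent x : lev (parent x) = (lev x).-1.
Proof.
have [->|/parentP[_ <-] //] := eqVneq x o.
by rewrite parent_root level_root.
Qed.

Lemma parent_unique x y : e x y -> (lev y < lev x)%N -> parent x = y.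
Proof.
move=> exy lyx; have xo : x != o.
  by apply/eqP => xo; move: lyx; rewrite xo level_root.
have [exp lp] := parentP xo; apply: (lower_unique exp exy lp).
by move: lyx; rewrite (tree_sym hT) in exy; have := level_edge exy; lia.
Qed.

(** The root has to be excluded: as [parent o = o], it would otherwise be its own child. *)
Definition is_child (x y : T) := (y != o) && (parent y == x).

Lemma is_childP x y : reflect (e x y /\ lev y = (lev x).+1) (is_child x y).
Proof.
apply: (iffP andP) => [[yo /eqP <-]|[exy ly]].
  by have [? <-] := parentP yo; rewrite (tree_sym hT).
split; first by apply/eqP => yo; move: ly; rewrite yo level_root.
apply/eqP; apply: parent_unique; last by lia.
by rewrite (tree_sym hT).
Qed.

Lemma edgeE x y : e x y = ((x != o) && (y == parent x)) || is_child x y.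
Proof.
apply/idP/orP => [exy|[/andP[xo /eqP ->]|/is_childP[] //]].
  have := level_edge_neq exy; rewrite neq_ltn => /orP[lxy|lyx].
    by right; apply/is_childP; split=> //; have := level_edge exy; lia.
  left; rewrite (parent_unique exy lyx) eqxx andbT.
  by apply/eqP => xo; move: lyx; rewrite xo level_root.
by case: (parentP xo).
Qed.

Lemma level_anc n x : lev (iter n parent x) = (lev x - n)%N.
Proof. by elim: n => [|n IHn]; rewrite ?subn0 //= level_parent IHn; lia. Qed.

Lemma dist_anc n x : (dist e (iter n parent x) x <= n)%N.
Proof.
elim: n => [|n IHn]; first by rewrite (distxx hT).
have := dist_triangle hT (iter n parent x) (iter n.+1 parent x) x.
suff : (dist e (iter n.+1 parent x) (iter n parent x) <= 1)%N by lia.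
rewrite /=; set y := iter n parent x.
have [->|yo] := eqVneq y o; first by rewrite parent_root (distxx hT).
by apply: (dist_edge hT); rewrite (tree_sym hT); case: (parentP yo).
Qed.

Lemma dist_level x y : (lev x <= dist e x y + lev y)%N.
Proof. exact: dist_triangle hT _ _ _. Qed.

(** Each step of a walk lowers the level by at most one, so a geodesic of length [n] that descends
    [n] levels can only pass through parents. *)
Lemma anc_of_dist n v x : dist e x v = n -> lev x = (n + lev v)%N ->
  v = iter n parent x.
Proof.
elim: n x => [|n IHn] x dn lx; first by rewrite /= (dist_eq0 hT dn).
have [y exy dy] := dist_step hT dn.
have ly : (lev y < lev x)%N by have := dist_level y v; lia.
rewrite iterSr (parent_unique exy ly) -IHn //.
by have := dist_level y v; rewrite (tree_sym hT) in exy; have := level_edge exy; lia.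
Qed.

Lemma geodesic_segE x v :
  geodesic_seg e o x v <-> (lev v <= lev x)%N /\ v = iter (lev x - lev v) parent x.
Proof.
rewrite /geodesic_seg /= (distC hT o v) (distC hT o x) -/(lev v) -/(lev x).
split=> [h|[lv vx]].
  split; first by lia.
  apply: anc_of_dist; first by rewrite (distC hT); lia.
  by lia.
have := dist_anc (lev x - lev v) x; rewrite -vx.
by have := dist_level x v; rewrite (distC hT x v); lia.
Qed.

(** * Rays, confluents and horocycle indices *)

Notation bd := (boundary e o).

Lemma level_ray (xi : bd) n : lev (sval xi n) = n.
Proof.
case: xi => xi /= [x0 dx].
by rewrite /level -x0 (distC hT) dx ?subn0.
Qed.

Lemma parent_ray (xi : bd) n : parent (sval xi n.+1) = sval xi n.
Proof.
apply: parent_unique; last by rewrite !level_ray.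
rewrite (tree_sym hT); apply: (dist1_edge hT).
by case: (svalP xi) => _ ->; rewrite ?subSnn.
Qed.

Lemma anc_ray (xi : bd) m n : iter m parent (sval xi (m + n)%N) = sval xi n.
Proof. by elim: m => [|m IHm] //; rewrite iterSr addSn parent_ray. Qed.

Lemma ray0 (xi : bd) : sval xi 0%N = o. Proof. by case: (svalP xi). Qed.

(** [u m] is the ancestor of [u n] lying [n - m] steps above it: [dist_anc] bounds their distance
    from above and the difference of levels bounds it from below. *)
Lemma is_ray_parent (u : nat -> T) : u 0%N = o ->
  (forall n, is_child (u n) (u n.+1)) -> is_ray e o u.
Proof.
move=> u0 uS; split=> // m n lemn.
have lu k : lev (u k) = k.
  elim: k => [|k IHk]; first by rewrite u0 level_root.
  by have /is_childP[_ ->] := uS k; rewrite IHk.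
have anc k : u m = iter k parent (u (k + m)%N).
  elim: k => [|k IHk] //.
  by rewrite iterSr addSn; have /andP[_ /eqP ->] := uS (k + m)%N.
have -> : u m = iter (n - m) parent (u n) by rewrite (anc (n - m)%N) subnK.
have := dist_anc (n - m) (u n).
have := dist_level (u n) (iter (n - m) parent (u n)).
by rewrite level_anc lu (distC hT (u n)); lia.
Qed.

Lemma boundary_arcE x (xi : bd) :
  boundary_arc x xi <-> sval xi (lev x) = x.
Proof.
split; first by move=> [n _ <-]; rewrite level_ray.
by move=> <-; exists (lev x).
Qed.

Lemma boundary_arc_ray (xi : bd) n : boundary_arc (sval xi n) xi.
Proof. by exists n. Qed.

Definition conf (x : T) (xi : bd) : nat := level e o (confluent x xi).

(** The segment from [o] to [x] consists of the ancestors of [x], so it meets [xi] at level [k]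
    exactly when [sval xi k] is the ancestor of [x] at that level. The confluent is at the largest
    such [k]; level 0 always qualifies. *)
Lemma confP x (xi : bd) : [/\ (conf x xi <= lev x)%N,
  sval xi (conf x xi) = iter (lev x - conf x xi) parent x &
  forall k, (k <= lev x)%N -> sval xi k = iter (lev x - k) parent x ->
    (k <= conf x xi)%N].
Proof.
pose P k := (k <= lev x)%N && (sval xi k == iter (lev x - k) parent x).
have inP v : (geodesic_seg e o x `&` vertices xi) v <-> P (lev v) /\ v = sval xi (lev v).
  split.
    move=> [/geodesic_segE[lv vx] [n _ nv]]; subst v.
    by rewrite level_ray in lv vx *; split=> //; rewrite /P lv; apply/eqP.
  move=> [/andP[lv /eqP E] vx]; split; last by exists (lev v).
  by apply/geodesic_segE; split=> //; rewrite -E.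
have exP : exists k, P k.
  exists 0%N; rewrite /P /= subn0 ray0 eq_sym; apply/eqP.
  by apply: level_eq0; rewrite level_anc subnn.
have boundP k : P k -> (k <= lev x)%N by case/andP.
have [k Pk kmax] := ex_maxnP exP boundP.
suff -> : conf x xi = k.
  have /andP[? /eqP ?] := Pk; split=> // m mx E; apply: kmax.
  by rewrite /P mx E eqxx.
rewrite /conf /confluent; case: xgetP => [v -> [/inP[Pv Ev] vmax]|].
  apply/eqP; rewrite eqn_leq kmax //=.
  have := vmax (sval xi k); rewrite level_ray; apply.
  by apply/inP; rewrite level_ray.
move=> /(_ (sval xi k)) []; split; first by apply/inP; rewrite level_ray.
by move=> w /inP[Pw _]; rewrite level_ray; exact: kmax.
Qed.

Lemma conf_unique x (xi : bd) k : (k <= lev x)%N ->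
  sval xi k = iter (lev x - k) parent x ->
  (forall j, (j <= lev x)%N -> sval xi j = iter (lev x - j) parent x -> (j <= k)%N) ->
  conf x xi = k.
Proof.
move=> kx Ek kmax; have [cx Ec cmax] := confP x xi.
by apply/eqP; rewrite eqn_leq kmax ?cmax.
Qed.

Lemma conf_on_ray (xi : bd) n : conf (sval xi n) xi = n.
Proof.
have [cx _ cmax] := confP (sval xi n) xi; move: cx cmax; rewrite level_ray => cx cmax.
by apply/eqP; rewrite eqn_leq cx cmax // subnn.
Qed.

(** Since [x] itself is not on the ray, every common vertex is already an ancestor of its parent. *)
Lemma conf_off_ray x (xi : bd) :
  sval xi (lev x) != x -> conf x xi = conf (parent x) xi.
Proof.
move=> xx; have xo : x != o.
  by apply/eqP => xo; move: xx; rewrite xo level_root ray0 eqxx.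
have [_ lx] := parentP xo; have [cx Ec cmax] := confP (parent x) xi.
apply: conf_unique; first by lia.
  by rewrite Ec -iterSr -subSn // lx.
move=> j; rewrite leq_eqVlt => /orP[/eqP ->|jx Ej].
  by rewrite subnn /= => E; rewrite E eqxx in xx.
apply: cmax; first by lia.
by rewrite Ej -iterSr -subSn ?lx //; lia.
Qed.

Lemma horocycleE x (xi : bd) :
  horocycle x xi = (2 * conf x xi)%:Z - (lev x)%:Z.
Proof. by []. Qed.

Lemma horocycle_on_ray (xi : bd) n : horocycle (sval xi n) xi = n%:Z.
Proof. by rewrite horocycleE conf_on_ray level_ray; lia. Qed.

Lemma horocycle_off_ray x (xi : bd) : sval xi (lev x) != x ->
  horocycle x xi = horocycle (parent x) xi - 1.
Proof.
move=> xx; have xo : x != o.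
  by apply/eqP => xo; move: xx; rewrite xo level_root ray0 eqxx.
have [_ lx] := parentP xo.
by rewrite !horocycleE conf_off_ray //; lia.
Qed.

(** The neighbour [y0] is the one towards [xi]: the next vertex of the ray if [x] lies on it, the
    parent of [x] otherwise. All other neighbours lead away from [xi]. *)
Lemma horocycle_next x (xi : bd) : exists2 y0, e x y0 &
  horocycle y0 xi = horocycle x xi + 1 /\
  forall y, e x y -> y != y0 -> horocycle y xi = horocycle x xi - 1.
Proof.
have [xx|xx] := eqVneq (sval xi (lev x)) x.
  have c0 : is_child x (sval xi (lev x).+1).
    apply/andP; rewrite parent_ray xx; split=> //.
    by apply/eqP => E; have := level_ray xi (lev x).+1; rewrite E level_root.
  exists (sval xi (lev x).+1); first by case/is_childP: c0.
  split; first by rewrite horocycle_on_ray -{2}xx horocycle_on_ray; lia.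
  move=> y; rewrite edgeE => /orP[/andP[xo /eqP ->] _|cy yx].
    case lx : (lev x) => [|n]; first by rewrite (level_eq0 lx) eqxx in xo.
    by rewrite -xx lx parent_ray !horocycle_on_ray; lia.
  have /andP[yo /eqP py] := cy; have /is_childP[_ ly] := cy.
  by rewrite horocycle_off_ray ?py // ly eq_sym.
have xo : x != o.
  by apply/eqP => xo; move: xx; rewrite xo level_root ray0 eqxx.
exists (parent x); first by rewrite edgeE xo eqxx.
split; first by rewrite (horocycle_off_ray xx); lia.
move=> y; rewrite edgeE => /orP[/andP[_ /eqP->]|/andP[yo /eqP py] _]; first by rewrite eqxx.
rewrite horocycle_off_ray ?py //; apply: contra xx => /eqP yy.
have /is_childP[_ ly] : is_child x y by rewrite /is_child yo py eqxx.
by rewrite -{2}py -yy ly parent_ray.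
Qed.

(** This makes the kernel at [x] locally constant in [xi], so that its integral against a
    distribution is a finite sum. *)
Lemma horocycle_same_arc x (xi eta : bd) n : (lev x <= n)%N ->
  sval xi n = sval eta n -> horocycle x xi = horocycle x eta.
Proof.
move=> xn E; have E' k : (k <= n)%N -> sval xi k = sval eta k.
  by move=> kn; rewrite -(anc_ray xi (n - k) k) -(anc_ray eta (n - k) k) subnK // E.
rewrite !horocycleE; congr ((2 * _)%:Z - _).
have [cx Ec cmax] := confP x eta; apply: conf_unique => //.
  by rewrite E' // (leq_trans cx).
by move=> j jx; rewrite E'; [exact: cmax|exact: leq_trans xn].
Qed.

(** * Neighbours, children and spheres as duplicate-free lists *)

Lemma neighbours_exist x :
  exists s : seq T, [/\ uniq s, size s = q.+1 & forall y, (y \in s) = e x y].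
Proof.
have hc := tree_degree hT x.
have fin : finite_set [set y | e x y] by exists q.+1.
exists (enum_fset (fset_set [set y | e x y])); split; first exact: fset_uniq.
  by have := card_fset_set hc.
by move=> y; rewrite in_fset_set //; apply/asboolP/idP.
Qed.

Definition neighbours x : seq T := sval (cid (neighbours_exist x)).

Lemma neighboursP x : [/\ uniq (neighbours x), size (neighbours x) = q.+1 &
  forall y, (y \in neighbours x) = e x y].
Proof. exact: svalP (cid (neighbours_exist x)). Qed.

Definition children x : seq T := [seq y <- neighbours x | is_child x y].

Lemma mem_children x y : (y \in children x) = is_child x y.
Proof.
rewrite mem_filter; have [_ _ ->] := neighboursP x.
by rewrite andb_idr // => /is_childP[].
Qed.

Lemma children_uniq x : uniq (children x).
Proof. by rewrite filter_uniq //; case: (neighboursP x). Qed.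

Lemma perm_neighbours_root : perm_eq (neighbours o) (children o).
Proof.
have [u _ me] := neighboursP o; apply: uniq_perm => //; first exact: children_uniq.
by move=> y; rewrite me mem_children edgeE eqxx.
Qed.

Lemma perm_neighbours x : x != o -> perm_eq (neighbours x) (parent x :: children x).
Proof.
move=> xo; have [u _ me] := neighboursP x; apply: uniq_perm => //.
  rewrite cons_uniq children_uniq mem_children andbT; apply/negP => /is_childP[_].
  by rewrite level_parent; lia.
by move=> y; rewrite me inE mem_children edgeE xo.
Qed.

Lemma size_children x : size (children x) = if x == o then q.+1 else q.
Proof.
have [_ s _] := neighboursP x; case: eqVneq => [xo|xo].
  by rewrite xo -(perm_size perm_neighbours_root) -xo.
by have := perm_size (perm_neighbours xo); rewrite s => -[].
Qed.

Fixpoint sphere n : seq T :=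
  if n is n'.+1 then flatten [seq children x | x <- sphere n'] else [:: o].

Lemma mem_sphere n x : (x \in sphere n) = (lev x == n).
Proof.
elim: n x => [|n IHn] x /=.
  by rewrite inE; apply/eqP/eqP => [->|/level_eq0 //]; rewrite level_root.
apply/flatten_mapP/eqP => [[y]|lx].
  by rewrite IHn mem_children => /eqP <- /is_childP[_].
have xo : x != o by apply: contra_eq_neq lx => ->; rewrite level_root.
exists (parent x); first by rewrite IHn level_parent lx.
by rewrite mem_children /is_child xo eqxx.
Qed.

Lemma sphere_uniq n : uniq (sphere n).
Proof.
elim: n => [|n IHn] //=.
elim: (sphere n) IHn => [|x s IHs] //= /andP[xs us].
rewrite cat_uniq children_uniq IHs // andbT /=.
apply/hasPn => y /flatten_mapP[z zs]; rewrite !mem_children => /andP[yo /eqP pz].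
by rewrite /is_child yo pz /=; apply: contraNneq xs => <-.
Qed.

Lemma size_sphere n : size (sphere n.+1) = (q.+1 * q ^ n)%N.
Proof.
elim: n => [|n IHn]; first by rewrite /= cats0 size_children eqxx muln1.
rewrite [sphere _]/= size_flatten /shape -map_comp expnSr mulnA -IHn.
have : {in sphere n.+1, forall x, (size \o children) x = q}.
  move=> x; rewrite mem_sphere => /eqP lx /=; rewrite size_children.
  by case: eqVneq lx => // ->; rewrite level_root.
rewrite -/(sphere n.+1). elim: (sphere n.+1) => [|x s IHs] /= sc; first by rewrite mul0n.
rewrite IHs.
  by have /= -> := sc x (mem_head _ _); rewrite mulSn.
by move=> y ys; apply: sc; rewrite inE ys orbT.
Qed.

Lemma ray_in_sphere (xi : bd) n : sval xi n \in sphere n.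
Proof. by rewrite mem_sphere level_ray. Qed.

End RootedTree.

(** * Dependence of the kernel on lambda *)

Section SmoothOn.
Variables (K : numFieldType) (Omega : set K).
Hypothesis openO : open Omega.

Definition smooth_on (f : K -> K^o) : Prop :=
  forall n l, Omega l -> derivable (derive1n n f) l 1.

Lemma near_eq_on (f g : K -> K^o) l :
  (forall m, Omega m -> f m = g m) -> Omega l -> \near l, f l = g l.
Proof.
move=> fg Ol; near=> m; apply: fg; near: m; exact: open_nbhs_nbhs.
Unshelve. all: by end_near. Qed.

(** By induction every iterated derivative agrees on [Omega] with a member of [C]; as [Omega] is
    open, this agreement passes to the next derivative. *)
Lemma smooth_of_class (C : (K -> K^o) -> Prop) :
  (forall f, C f -> exists2 g, C g & forall l, Omega l -> is_derive l 1 f (g l)) ->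
  forall f, C f -> smooth_on f.
Proof.
move=> CD f Cf; suff H n : exists2 g, C g & forall l, Omega l -> derive1n n f l = g l.
  move=> n l Ol; have [g Cg E] := H n; have [g' _ /(_ l Ol) [dg _]] := CD g Cg.
  apply: near_eq_derivable dg.
  by apply: near_eq_on => // m Om; rewrite E.
elim: n => [|n [g Cg E]]; first by exists f.
have [g' Cg' dg] := CD g Cg; exists g' => // l Ol.
rewrite derive1nS derive1E; have [_ <-] := dg l Ol.
by apply: near_eq_derive; exact: near_eq_on.
Qed.

(** The Leibniz rule for [l * k l]: only the first two terms survive because the first factor is
    linear. *)
Lemma derive1n_recurrence (f g k : K -> K) (b N : K) :
  smooth_on f -> smooth_on g -> smooth_on k ->
  (forall l, Omega l -> f l + b * g l = N * (l * k l)) ->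
  forall n l, Omega l ->
  derive1n n f l + b * derive1n n g l =
  N * (l * derive1n n k l + n%:R * derive1n n.-1 k l).
Proof.
move=> sf sg sk E; elim=> [|n IHn] l Ol; first by rewrite /= mul0r addr0 E.
pose F : K -> K^o := derive1n n f + cst b * derive1n n g.
pose G : K -> K^o := cst N * (id * derive1n n k + cst n%:R * derive1n n.-1 k).
have -> : derive1n n.+1 f l + b * derive1n n.+1 g l = 'D_1 F l.
  have df := derivableP (sf n l Ol); have dg := derivableP (sg n l Ol).
  rewrite !derive1nS !derive1E.
  have dF := is_deriveD df (is_deriveM (is_derive_cst (b : K^o) (l : K^o) 1) dg).
  by case: dF => _ ->; rewrite scaler0 addr0.
rewrite (_ : 'D_1 F l = 'D_1 G l); last first.
  by apply: near_eq_derive; apply: near_eq_on => // m Om; exact: IHn.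
have dk := derivableP (sk n l Ol).
have dk1 : is_derive l 1 (derive1n n.-1 k : K -> K^o) ('D_1 (derive1n n.-1 k : K -> K^o) l).
  exact: derivableP (sk _ l Ol).
have dG := is_deriveM (is_derive_cst (N : K^o) (l : K^o) 1)
  (is_deriveD (is_deriveM (is_derive_id (l : K^o) 1) dk)
    (is_deriveM (is_derive_cst (n%:R : K^o) (l : K^o) 1) dk1)).
case: dG => _ ->; rewrite !scaler0 !addr0 derive1nS derive1E /GRing.scale /= mulr1.
rewrite -addrA; congr (_ * (_ + _)).
(* For [n = 0] the truncated predecessor gives the wrong order of derivative, but its coefficient is
   0. *)
case: n {IHn F G dk dk1} => [|n]; first by rewrite mul0r addr0 mul1r.
by rewrite -derive1E -derive1nS /= -[n.+2]add1n natrD mulrDl mul1r.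
Qed.

End SmoothOn.

(** * Smoothness of an inverse branch of the Joukowski map [w + s ^+ 2 / w] *)

Section JoukowskiBranch.
Variables (K : numFieldType) (Omega : set K) (N s : K) (w : K -> K).
Hypothesis openO : open Omega.
Hypotheses (N0 : 0 < N) (s0 : 0 < s).
Hypothesis w_gt : forall l, Omega l -> s < `|w l|.
Hypothesis w_eq : forall l, Omega l -> w l + s ^+ 2 / w l = N * l.

Lemma branch_neq0 l : Omega l -> w l != 0.
Proof. by move=> /w_gt H; rewrite -normr_gt0 (lt_trans s0). Qed.

(** Subtracting two instances of [w_eq] and factoring out [w m - w l] gives the difference quotient
    of [w] in closed form, from which continuity and then the derivative are read off. *)
Lemma branch_factor l m : Omega l -> Omega m ->
  (w m - w l) * (1 - s ^+ 2 / (w m * w l)) = N * (m - l).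
Proof.
move=> Ol Om; rewrite [RHS]mulrBr -!w_eq //.
by field; rewrite !branch_neq0.
Qed.

Let c l : K := 1 - s / `|w l|.

Lemma branch_gap l : Omega l -> 0 < c l.
Proof.
move=> Ol; have wl : 0 < `|w l| by rewrite (lt_trans s0) ?w_gt.
by rewrite subr_gt0 ltr_pdivrMr // mul1r w_gt.
Qed.

(** Because [s < |w m|], the second factor in [branch_factor] has modulus at least [c l], uniformly
    in [m]. *)
Lemma branch_lipschitz l m : Omega l -> Omega m ->
  `|w m - w l| <= N / c l * `|m - l|.
Proof.
move=> Ol Om; have cl := branch_gap Ol.
have wl : 0 < `|w l| by rewrite (lt_trans s0) ?w_gt.
have wm : 0 < `|w m| by rewrite (lt_trans s0) ?w_gt.
rewrite mulrAC ler_pdivlMr // -[X in _ <= X * _](gtr0_norm N0) -normrM.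
rewrite -branch_factor // normrM ler_wpM2l //.
apply: le_trans (lerB_dist _ _); rewrite normr1 lerB //.
rewrite !(normrM, normfV, normrX) (gtr0_norm s0).
rewrite ler_pdivrMr ?mulr_gt0 //.
rewrite [X in _ <= X](_ : _ = s * `|w m|); last by field; rewrite gt_eqF.
by rewrite ler_pM2l // ltW // w_gt.
Qed.

Lemma branch_continuous l : Omega l -> w m @[m --> l] --> w l.
Proof.
move=> Ol; apply/(@cvgrPdist_lt _ _ _ (nbhs l)) => eps eps0.
have C0 : 0 < N / c l by rewrite divr_gt0 ?branch_gap.
near=> m; rewrite distrC; apply: le_lt_trans (branch_lipschitz Ol _) _.
  by near: m; exact: open_nbhs_nbhs.
rewrite mulrC -ltr_pdivlMr // distrC; near: m.
by apply: nbhsx_ballx; rewrite divr_gt0.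
Unshelve. all: by end_near. Qed.

Lemma branch_disc_neq0 l : Omega l -> 1 - s ^+ 2 / (w l * w l) != 0.
Proof.
move=> Ol; have wl : 0 < `|w l| by rewrite (lt_trans s0) ?w_gt.
rewrite subr_eq0; apply/eqP => /(congr1 Num.norm).
rewrite normr1 !(normrM, normfV, normrX) (gtr0_norm s0) => E.
have : s ^+ 2 / (`|w l| * `|w l|) < 1.
  rewrite ltr_pdivrMr ?mulr_gt0 // mul1r.
  by rewrite ltr_pM ?w_gt ?ltW.
by rewrite -E ltxx.
Qed.

Lemma branch_derive l : Omega l ->
  is_derive l 1 w (N / (1 - s ^+ 2 / (w l * w l))).
Proof.
move=> Ol; have wl0 := branch_neq0 Ol.
suff H : h^-1 *: ((w \o shift l) (h *: 1) - w l) @[h --> 0^'] -->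
    N / (1 - s ^+ 2 / (w l * w l)).
  apply: DeriveDef; last exact: cvg_lim.
  by apply/cvg_ex; eexists; exact: H.
have hl : h + l @[h --> 0^'] --> l.
  apply: cvg_within_filter; apply/(@cvgrPdist_lt _ _ _ (nbhs (0 : K))) => eps eps0.
  near=> h; rewrite opprD addrCA subrr addr0 normrN; near: h.
  exact: (@nbhs0_lt K K^o).
have cw : w (h + l) @[h --> 0^'] --> w l.
  by apply: cvg_comp hl _; exact: branch_continuous.
have : N / (1 - s ^+ 2 / (w (h + l) * w l)) @[h --> 0^'] -->
    N / (1 - s ^+ 2 / (w l * w l)).
  apply: cvgM; first exact: cvg_cst.
  apply: cvgV; first exact: branch_disc_neq0.
  apply: cvgB; first exact: cvg_cst.
  apply: cvgM; first exact: cvg_cst.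
  apply: cvgV; first by rewrite mulf_neq0.
  by apply: cvgM => //; exact: cvg_cst.
apply: cvg_trans; apply: near_eq_cvg.
near=> h; rewrite /= [h *: 1]mulr1.
have h0 : h != 0 by near: h; exact: nbhs_dnbhs_neq.
have Oh : Omega (h + l).
  near: h; apply: (hl Omega); exact: open_nbhs_nbhs.
have := branch_factor Ol Oh; rewrite addrK; set D := 1 - _ => E.
have D0 : D != 0.
  apply/eqP => D0; move: E; rewrite D0 mulr0 => /esym/eqP.
  by rewrite mulf_eq0 gt_eqF // (negbTE h0).
by apply: (mulIf D0); rewrite mulfVK // -mulrA E mulrCA mulVf // mulr1.
Unshelve. all: by end_near. Qed.

(** The derivative of [w] is [N / (1 - s ^+ 2 / (w * w))]. Adjoining the inverse of this denominator
    and that of [w] gives an algebra closed under differentiation, hence made of smooth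
    functions. *)
Inductive branch_alg : (K -> K^o) -> Prop :=
| branch_alg_cst a : branch_alg (cst a)
| branch_alg_w : branch_alg w
| branch_alg_inv : branch_alg (fun l => (w l)^-1)
| branch_alg_disc : branch_alg (fun l => (1 - s ^+ 2 / (w l * w l))^-1)
| branch_alg_add f g : branch_alg f -> branch_alg g -> branch_alg (f + g)
| branch_alg_mul f g : branch_alg f -> branch_alg g -> branch_alg (f * g).

Lemma is_derive_inv (f : K -> K^o) l df : f l != 0 ->
  is_derive l 1 f df -> is_derive l 1 (fun m => (f m)^-1) (- (f l) ^- 2 * df).
Proof.
move=> fl0 [dfl <-]; apply: DeriveDef; first exact: derivableV.
exact: deriveV.
Qed.

Lemma branch_alg_derive f : branch_alg f ->
  exists2 g, branch_alg g & forall l, Omega l -> is_derive l 1 f (g l).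
Proof.
pose v l := (1 - s ^+ 2 / (w l * w l))^-1.
pose dw : K -> K^o := cst N * v.
have dwP l : Omega l -> is_derive l 1 w (dw l) by exact: branch_derive.
have Cdw : branch_alg dw by apply: branch_alg_mul; [exact: branch_alg_cst|exact: branch_alg_disc].
pose wi : K -> K^o := fun l => (w l)^-1.
have Cwi : branch_alg wi by exact: branch_alg_inv.
pose dwi : K -> K^o := cst (-1) * (wi * wi * dw).
have dwiP l : Omega l -> is_derive l 1 wi (dwi l).
  move=> Ol; have wl0 := branch_neq0 Ol.
  apply: is_derive_eq (is_derive_inv wl0 (dwP l Ol)) _.
  by rewrite /dwi /wi !fctE -invfM -expr2 mulN1r mulNr.
have Cdwi : branch_alg dwi.
  exact: branch_alg_mul (branch_alg_cst _) (branch_alg_mul (branch_alg_mul Cwi Cwi) Cdw).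
elim=> [a|||| f1 f2 _ [g1 C1 D1] _ [g2 C2 D2]|f1 f2 C1' [g1 C1 D1] C2' [g2 C2 D2]].
- exists (cst 0); first exact: branch_alg_cst.
  by move=> l _; exact: is_derive_cst.
- by exists dw.
- by exists dwi.
- pose D : K -> K^o := cst 1 + cst (- s ^+ 2) * (wi * wi).
  pose dD : K -> K^o := cst (- s ^+ 2) * (wi * dwi + wi * dwi).
  have DE : (fun l => (1 - s ^+ 2 / (w l * w l))^-1) = (fun l => (D l)^-1).
    by apply/funext => l; rewrite /D /wi !fctE invfM mulNr.
  have dDP l : Omega l -> is_derive l 1 D (dD l).
    move=> Ol; have dwil := dwiP l Ol.
    apply: is_derive_eq (is_deriveD (is_derive_cst (1 : K^o) (l : K^o) 1)
      (is_deriveM (is_derive_cst (- s ^+ 2 : K^o) (l : K^o) 1)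
        (is_deriveM dwil dwil))) _.
    by rewrite /dD !fctE /GRing.scale /= mulr0 addr0 add0r.
  exists (cst (-1) * (v * v * dD)).
    apply: branch_alg_mul; first exact: branch_alg_cst.
    apply: branch_alg_mul; first by apply: branch_alg_mul; exact: branch_alg_disc.
    apply: branch_alg_mul; first exact: branch_alg_cst.
    by apply: branch_alg_add; apply: branch_alg_mul.
  move=> l Ol; have vE : v l = (D l)^-1 by exact: (congr1 (@^~ l) DE).
  have Dl0 : D l != 0 by rewrite -invr_eq0 -vE invr_eq0 branch_disc_neq0.
  rewrite DE; apply: is_derive_eq (is_derive_inv Dl0 (dDP l Ol)) _.
  by rewrite !fctE vE -invfM -expr2 mulN1r mulNr.
- exists (g1 + g2); first exact: branch_alg_add.
  by move=> l Ol; apply: is_deriveD; [exact: D1|exact: D2].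
- exists (f1 * g2 + f2 * g1).
    by apply: branch_alg_add; apply: branch_alg_mul.
  by move=> l Ol; apply: is_deriveM; [exact: D1|exact: D2].
Qed.

Lemma branch_smooth_exprz (h : int) :
  smooth_on Omega (fun l => (w l : K) ^ h : K^o).
Proof.
apply: (smooth_of_class openO branch_alg_derive).
have pos (f : K -> K^o) n : branch_alg f -> branch_alg (fun l => f l ^+ n : K^o).
  move=> Cf; elim: n => [|n IHn]; first exact: branch_alg_cst.
  rewrite (_ : (fun _ => _) = f * (fun l => f l ^+ n : K^o)); first exact: branch_alg_mul.
  by apply/funext => l; rewrite exprS.
case: h => n; first by apply: pos; exact: branch_alg_w.
rewrite (_ : (fun _ => _) = (fun l => (w l)^-1 ^+ n.+1 : K^o)); last first.
  by apply/funext => l; rewrite exprVn.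
by apply: pos; exact: branch_alg_inv.
Qed.

(** Multiply [w_eq] by [w ^ h] and differentiate [n] times. *)
Lemma branch_exprz_recurrence (h : int) n l : Omega l ->
  derive1n n (fun l => w l ^ (h + 1) : K^o) l +
    s ^+ 2 * derive1n n (fun l => w l ^ (h - 1) : K^o) l =
  N * (l * derive1n n (fun l => w l ^ h : K^o) l +
    n%:R * derive1n n.-1 (fun l => w l ^ h : K^o) l).
Proof.
apply: (derive1n_recurrence openO); try exact: branch_smooth_exprz.
move=> m Om; have wm := branch_neq0 Om.
rewrite !expfzDr // expr1z exprN1 [RHS]mulrA -w_eq // mulrDl [_ * w m]mulrC.
by rewrite [in LHS]mulrA [in LHS]mulrAC.
Qed.

End JoukowskiBranch.

(** * Complex powers of [q], the choice of [zeta], and the derivatives of the kernel *)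

Section Kernel.
Variables (R : realType) (q : nat).
Hypothesis hq : (2 <= q)%N.
Implicit Types z l : R[i].

Let qR_gt1 : 1 < q%:R :> R. Proof. by rewrite ltr1n. Qed.
Let qR_gt0 : 0 < q%:R :> R. Proof. by rewrite ltr0n; lia. Qed.
Let lnq_gt0 : 0 < ln q%:R :> R. Proof. exact: ln_gt0. Qed.

Lemma qpowD z1 z2 : qpow q (z1 + z2) = qpow q z1 * qpow q z2.
Proof.
case: z1 z2 => [a b] [c d]; rewrite /qpow; simpc => /=.
by rewrite !mulrDl expRD cosD sinD; congr Complex; ring.
Qed.

Lemma qpow0 : qpow q 0 = 1 :> R[i].
Proof. by rewrite /qpow /= !mul0r expR0 cos0 sin0 !mul1r. Qed.

Lemma qpow1 : qpow q 1 = q%:R :> R[i].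
Proof.
rewrite /qpow /= mul1r mul0r cos0 sin0 mulr1 mulr0 lnK ?posrE //.
by rewrite -[LHS]/(q%:R%:C) rmorph_nat.
Qed.

Lemma qpow_neq0 z : qpow q z != 0.
Proof.
apply/eqP => z0; have := qpowD z (- z).
by rewrite subrr qpow0 z0 mul0r => /eqP; rewrite oner_eq0.
Qed.

Lemma qpowN z : qpow q (- z) = (qpow q z)^-1.
Proof.
by apply: (mulfI (qpow_neq0 z)); rewrite -qpowD subrr qpow0 divff ?qpow_neq0.
Qed.

Lemma qpow_compl z : qpow q (1 - z) = q%:R / qpow q z.
Proof. by rewrite qpowD qpow1 qpowN. Qed.

Lemma qpow_int z (h : int) : qpow q (z * h%:~R) = qpow q z ^ h.
Proof.
have pos n : qpow q (z * n%:R) = qpow q z ^+ n.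
  elim: n => [|n IHn]; first by rewrite mulr0 qpow0.
  by rewrite -natr1 mulrDr mulr1 qpowD IHn exprSr.
case: h => n; first exact: pos.
by rewrite NegzE rmorphN mulrN qpowN pos exprnN.
Qed.

Lemma norm_qpow z : `|qpow q z| = (expR (complex.Re z * ln q%:R))%:C.
Proof.
rewrite normc_def /= !exprMn -mulrDr cos2Dsin2 mulr1 sqrtr_sqr ger0_norm //.
Qed.

Lemma expR_half_ln : expR (2^-1 * ln q%:R) = Num.sqrt (q%:R : R).
Proof.
have E2 : expR (2^-1 * ln q%:R) ^+ 2 = q%:R :> R.
  by rewrite expr2 -expRD -mulrDl -[RHS]lnK ?posrE //; congr expR; field.
by rewrite -[in RHS]E2 sqrtr_sqr ger0_norm // expR_ge0.
Qed.

Lemma norm_qpow_gt z : 2^-1 < complex.Re z ->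
  (Num.sqrt q%:R)%:C < `|qpow q z|.
Proof. by move=> hz; rewrite norm_qpow ltcR -expR_half_ln ltr_expR ltr_pM2r. Qed.

Lemma polar (c d : R) : c ^+ 2 + d ^+ 2 = 1 ->
  exists t : R, [/\ `|t| <= pi, cos t = c & sin t = d].
Proof.
move=> cd; have c1 : -1 <= c <= 1.
  by rewrite -ler_norml -(@ler_pXn2r _ 2) ?nnegrE // expr1n real_normK ?num_real //;
     rewrite -cd lerDl sqr_ge0.
have E : 1 - c ^+ 2 = d ^+ 2 by rewrite -cd addrC addKr.
have a0 := acos_ge0 c1; have api := acos_lepi c1.
have [d0|d0] := leP 0 d.
  exists (acos c); split; first by rewrite ger0_norm.
    by rewrite acosK // in_itv.
  by rewrite sin_acos // E sqrtr_sqr ger0_norm.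
exists (- acos c); split; first by rewrite normrN ger0_norm.
  by rewrite cosN acosK // in_itv.
by rewrite sinN sin_acos // E sqrtr_sqr ltr0_norm // opprK.
Qed.

(** The witness is the logarithm of [v] in base [q], its argument being taken between [- pi] and
    [pi]. *)
Lemma qpow_surj (v : R[i]) : (Num.sqrt q%:R)%:C < `|v| ->
  exists z, [/\ 2^-1 < complex.Re z, `|complex.Im z| <= pi / ln q%:R & qpow q z = v].
Proof.
case: v => a b; rewrite normc_def /= ltcR => hv.
set r := Num.sqrt (a ^+ 2 + b ^+ 2) in hv.
have r0 : 0 < r by rewrite (le_lt_trans _ hv) // sqrtr_ge0.
have r2 : r ^+ 2 = a ^+ 2 + b ^+ 2 by rewrite sqr_sqrtr // addr_ge0 ?sqr_ge0.
have [t [tpi ct st]] : exists t, [/\ `|t| <= pi, cos t = a / r & sin t = b / r].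
  by apply: polar; rewrite !exprMn -mulrDl -r2 -exprMn divff ?gt_eqF // expr1n.
exists ((ln r / ln q%:R) +i* (t / ln q%:R)); split => /=.
- by rewrite ltr_pdivlMr // -ltr_expR expR_half_ln lnK.
- by rewrite normrM normfV (gtr0_norm lnq_gt0) ler_pM2r ?invr_gt0.
- rewrite /qpow /= !divfK ?gt_eqF // lnK // ct st.
  by congr Complex; rewrite mulrC divfK ?gt_eqF.
Qed.

(* The complement of the segment [[-rho, rho]]. *)
Definition outer_domain : set R[i] := [set l |
  complex.Im l != 0 \/ 2 * Num.sqrt q%:R < q.+1%:R * `|complex.Re l|].

Lemma complex_ball_Re_Im (l m : R[i]) (e : R) : `|l - m| < e%:C ->
  `|complex.Re l - complex.Re m| < e /\ `|complex.Im l - complex.Im m| < e.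
Proof.
case: l m => [a b] [c d]; rewrite normc_def /= ltcR => h.
split; apply: le_lt_trans h; rewrite -sqrtr_sqr ler_wsqrtr //.
  by rewrite lerDl sqr_ge0.
by rewrite lerDr sqr_ge0.
Qed.

Lemma open_outer_domain : open (outer_domain : set R[i]^o).
Proof.
have N0 : 0 < q.+1%:R :> R by rewrite ltr0Sn.
move=> l [l0|hl].
  have e0 : 0 < (`|complex.Im l|)%:C :> R[i] by rewrite ltcR normr_gt0.
  exists (`|complex.Im l|)%:C; first exact: e0.
  move=> m hm; have [_ h] := @complex_ball_Re_Im l m _ hm; left; apply/eqP => m0.
  by move: h; rewrite m0 subr0 ltxx.
have e0 : 0 < (`|complex.Re l| - 2 * Num.sqrt q%:R / q.+1%:R)%:C :> R[i].
  by rewrite ltcR subr_gt0 ltr_pdivrMr // [ltRHS]mulrC.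
exists (`|complex.Re l| - 2 * Num.sqrt q%:R / q.+1%:R)%:C; first exact: e0.
move=> m hm; have [h _] := @complex_ball_Re_Im l m _ hm; right.
rewrite [ltRHS]mulrC -ltr_pdivrMr //.
have := lerB_dist (complex.Re l) (complex.Re m).
by move: h; set x := _ / _; lra.
Qed.

(** The roots [v1], [v2] of [v ^+ 2 - a * v + q], where [a = (q + 1) * l], have product [q]. If
    neither exceeds [sqrt q] in modulus they are conjugate, so their sum [a] is real and at most
    [2 * sqrt q] in modulus, which puts [l] on the excluded segment. *)
Lemma branch_exists l : outer_domain l -> exists v : R[i],
  (Num.sqrt q%:R)%:C < `|v| /\ v + q%:R / v = q.+1%:R * l.
Proof.
move=> Ol; pose a : R[i] := q.+1%:R * l; pose r := sqrtC (a ^+ 2 - 4 * q%:R).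
have r2 : r ^+ 2 = a ^+ 2 - 4 * q%:R by rewrite sqrtCK.
pose v1 := (a + r) / 2; pose v2 := (a - r) / 2.
have v12 : v1 * v2 = q%:R.
  by rewrite /v1 /v2 mulf_div [(a + r) * _]mulrC -subr_sqr r2 opprB addrC subrK; field.
have sum : v1 + v2 = a by rewrite /v1 /v2; field.
have q0 : q%:R != 0 :> R[i] by rewrite pnatr_eq0; lia.
have v10 : v1 != 0 by apply: contraNneq q0 => E; rewrite -v12 E mul0r.
have v20 : v2 != 0 by apply: contraNneq q0 => E; rewrite -v12 E mulr0.
have [h1|h1] := boolP ((Num.sqrt q%:R)%:C < `|v1|).
  by exists v1; split => //; rewrite -v12 mulrAC divff // mul1r.
have [h2|h2] := boolP ((Num.sqrt q%:R)%:C < `|v2|).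
  by exists v2; split => //; rewrite -v12 mulfK // addrC.
exfalso; have qs : Num.sqrt (q%:R : R) ^+ 2 = q%:R by rewrite sqr_sqrtr // ltW.
have small (v : R[i]) : ~~ ((Num.sqrt q%:R)%:C < `|v|) ->
    complex.Re v ^+ 2 + complex.Im v ^+ 2 <= q%:R.
  rewrite normc_def ltcR -leNgt => hv; rewrite -qs -(@sqr_sqrtr _ (_ + _)).
    by rewrite ler_pXn2r // nnegrE sqrtr_ge0.
  by rewrite addr_ge0 ?sqr_ge0.
have {h1}n1 := small _ h1; have {h2}n2 := small _ h2.
have [Re12 Im12] : complex.Re v1 * complex.Re v2 - complex.Im v1 * complex.Im v2 = q%:R
   /\ complex.Re v1 * complex.Im v2 + complex.Im v1 * complex.Re v2 = 0.
  have : v1 * v2 = (q%:R : R)%:C by rewrite v12 rmorph_nat.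
  by case: (v1) (v2) => [x y] [x' y'] /=; simpc => -[].
have [Re_sum Im_sum] : complex.Re v1 + complex.Re v2 = q.+1%:R * complex.Re l /\
    complex.Im v1 + complex.Im v2 = q.+1%:R * complex.Im l.
  have : v1 + v2 = (q.+1%:R : R)%:C * l by rewrite sum rmorph_nat.
  by case: (v1) (v2) (l) => [x y] [x' y'] [c d] /=; simpc => -[].
move: n1 n2 Re12 Im12 Re_sum Im_sum.
move: (complex.Re v1) (complex.Im v1) (complex.Re v2) (complex.Im v2) => x y x' y'.
move=> n1 n2 E1 E2 E3 E4.
(* The left side is [|v1|^2 + |v2|^2 - 2 Re (v1 v2)], at most [2 q - 2 q]; its vanishing says that
   the roots are conjugate. *)
have : (x - x') ^+ 2 + (y + y') ^+ 2 <= 0 by nra.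
have h1 := sqr_ge0 (x - x'); have h2 := sqr_ge0 (y + y') => h.
have /eqP : (y + y') ^+ 2 == 0 by rewrite eq_le sqr_ge0 andbT; lra.
have /eqP : (x - x') ^+ 2 == 0 by rewrite eq_le sqr_ge0 andbT; lra.
move=> /eqP; rewrite sqrf_eq0 subr_eq0 => /eqP xx.
move=> /eqP; rewrite sqrf_eq0 => /eqP yy.
have N0 : q.+1%:R != 0 :> R by rewrite pnatr_eq0.
case: Ol => [/eqP|]; first apply.
  by apply: (mulfI N0); rewrite -E4 yy mulr0.
apply/negP; rewrite -leNgt.
have -> : q.+1%:R * `|complex.Re l| = 2 * `|x|.
  rewrite -[q.+1%:R]ger0_norm // -normrM -E3 -xx (_ : x + x = 2 * x); last by ring.
  by rewrite normrM ger0_norm.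
rewrite ler_pM2l // -sqrtr_sqr ler_wsqrtr //; have := sqr_ge0 y; lra.
Qed.

Let w (l : R[i]) : R[i] := qpow q (zeta q l).
Let s : R[i] := (Num.sqrt q%:R)%:C.

(** Off the segment [branch_exists] and [qpow_surj] provide an admissible exponent, so [xget] does
    not return its default, and any exponent it picks satisfies both conditions. *)
Lemma zetaP l : outer_domain l -> s < `|w l| /\ w l + s ^+ 2 / w l = q.+1%:R * l.
Proof.
move=> Ol; have [v [hv Ev]] := branch_exists Ol.
have [z [z1 z2 zv]] := qpow_surj hv.
have N0 : q.+1%:R != 0 :> R[i] by rewrite pnatr_eq0.
have -> : s ^+ 2 = q%:R.
  by rewrite -rmorphXn /= sqr_sqrtr ?ltW // rmorph_nat.
rewrite /w /zeta; case: xgetP => [y _ [y1 y2 ->]|/(_ z) []].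
  split; first exact: norm_qpow_gt.
  by rewrite [RHS]mulrC divfK // qpow_compl.
by split => //; rewrite qpow_compl zv Ev [RHS]mulrC mulKf.
Qed.

(** Since [x] and [xi] enter the kernel only through the horocycle index [h], its derivatives in the
    spectral parameter form a family indexed by integers. *)
Definition kernel_coeff (n : nat) (h : int) (l : R[i]) : R[i] :=
  derive1n n (fun m => w m ^ h : R[i]^o) l.

Lemma poisson_kernel_nE (T : choiceType) (e : rel T) (o : T) n x
    (xi : boundary e o) l :
  poisson_kernel_n q n x xi l = kernel_coeff n (horocycle x xi) l.
Proof.
rewrite /poisson_kernel_n (_ : poisson_kernel q x xi = fun m => w m ^ horocycle x xi) //.
by apply/funext => m; rewrite /poisson_kernel qpow_int.
Qed.

(** The branch recurrence with [s = sqrt q] and [N = q + 1]. As one neighbour has index [h + 1] and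
    [q] have index [h - 1], it expresses that [P - l] sends the [n]-th derivative of the kernel to
    [n] times the preceding one. *)
Lemma kernel_coeff_recurrence n (h : int) l : outer_domain l ->
  kernel_coeff n (h + 1) l + q%:R * kernel_coeff n (h - 1) l =
  q.+1%:R * (l * kernel_coeff n h l + n%:R * kernel_coeff n.-1 h l).
Proof.
have -> : q%:R = s ^+ 2 by rewrite -rmorphXn /= sqr_sqrtr ?ltW // rmorph_nat.
apply: (branch_exprz_recurrence open_outer_domain).
- by rewrite ltr0Sn.
- by rewrite /s ltcR sqrtr_gt0.
- by move=> m /zetaP[].
- by move=> m /zetaP[].
Qed.

Lemma kernel_coeff0 (h : int) l : kernel_coeff 0 h l = w l ^ h.
Proof. by []. Qed.

Lemma branch_norm_gt1 l : outer_domain l -> 1 < `|w l|.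
Proof.
move=> /zetaP[h _]; apply: lt_trans h; rewrite -[1]/(1%:C) ltcR -[X in X < _]sqrtr1.
by rewrite ltr_sqrt ?ltr01.
Qed.

End Kernel.

(** * The spectrum on l^2 *)

Section Spectrum.
Variables (R : realType) (q : nat).
Hypothesis hq : (2 <= q)%N.

(* [A (n+1)^2 - a A n A (n+1) + q A n^2] is multiplied by [q] at each step of
   the recurrence and is a nonnegative quadratic form. *)
Lemma radial_not_square_summable (A b : nat -> R) (a : R) :
  a ^+ 2 <= 4 * q%:R ->
  A 1%N = a * A 0%N + q.+1%:R ->
  A 2%N = a * A 1%N - q.+1%:R * A 0%N ->
  (forall n, A n.+3 = a * A n.+2 - q%:R * A n.+1) ->
  (forall n, A n.+1 ^+ 2 <= q.+1%:R * q%:R ^+ n * b n.+1) ->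
  b @ \oo --> (0 : R) -> False.
Proof.
move=> ha A1 A2 A3 hb b0.
have q0 : 0 < q%:R :> R by rewrite ltr0n; lia.
have q1 : 0 < q.+1%:R :> R by rewrite ltr0Sn.
pose E n := A n.+2 ^+ 2 - a * A n.+1 * A n.+2 + q%:R * A n.+1 ^+ 2.
have ES n : E n = q%:R ^+ n * E 0%N.
  elim: n => [|n IHn]; first by rewrite mul1r.
  by rewrite exprS -mulrA -IHn /E A3; ring.
have Esq n : E n = (A n.+2 - a / 2 * A n.+1) ^+ 2 + (q%:R - a ^+ 2 / 4) * A n.+1 ^+ 2.
  by rewrite /E; field.
have c0 : 0 <= q%:R - a ^+ 2 / 4 by rewrite subr_ge0 ler_pdivrMr // mulrC.
have Ege n : 0 <= E n by rewrite Esq addr_ge0 ?sqr_ge0 // mulr_ge0 ?sqr_ge0.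
have small (c C : R) : (forall n, c <= C * (b n.+1 + b n.+2)) -> c <= 0.
  move=> hc; have cv : C * (b n.+1 + b n.+2) @[n --> \oo] --> (0 : R).
    rewrite [X in _ --> X](_ : _ = C * (0 + 0)); last by rewrite addr0 mulr0.
    apply: cvgM; first exact: cvg_cst.
    by apply: cvgD; [move: b0; rewrite -cvg_shiftS|
      move: b0; rewrite -cvg_shiftS -cvg_shiftS].
  rewrite -(cvg_lim (@Rhausdorff R) cv).
  apply: limr_ge; first by apply/cvg_ex; exists 0.
  by near=> n; exact: hc.
(* [E n] equals [q ^ n] times [E 0], while [hb] bounds it by [q ^ n] times a combination of terms of
   [b], which tend to 0. *)
have E0 : E 0%N = 0.
  apply/eqP; rewrite eq_le Ege andbT; apply: (small _ (3 * q.+1%:R * q%:R)) => n.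
  have h1 := hb n; have h2 := hb n.+1.
  have qn : 0 < q%:R ^+ n :> R by rewrite exprn_gt0.
  rewrite -(ler_pM2l qn) -ES.
  have b1 : 0 <= b n.+1.
    by rewrite -(pmulr_rge0 _ (mulr_gt0 q1 qn)); apply: le_trans h1; exact: sqr_ge0.
  (* The cross term is at most half of [A n.+2 ^+ 2 + a ^+ 2 * A n.+1 ^+ 2], and [a ^+ 2 <= 4 q]. *)
  have : E n <= 3 / 2 * A n.+2 ^+ 2 + 3 * q%:R * A n.+1 ^+ 2.
    have := sqr_ge0 (A n.+2 + a * A n.+1).
    have : a ^+ 2 * A n.+1 ^+ 2 <= 4 * q%:R * A n.+1 ^+ 2.
      by rewrite ler_wpM2r ?sqr_ge0.
    by rewrite /E; lra.
  move=> /le_trans; apply.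
  rewrite [q%:R ^+ n.+1]exprS in h2.
  have := ler_wpM2l (ltW q0) h1; have := mulr_ge0 (ltW (mulr_gt0 (mulr_gt0 q0 q1) qn)) b1.
  have := sqr_ge0 (A n.+2); move: h2.
  move: (q%:R : R) (q.+1%:R : R) (b n.+2) (b n.+1) (A n.+2 ^+ 2) (A n.+1 ^+ 2) (q%:R ^+ n).
  move=> t s v u y x Q h2 h3 h4 h5.
  rewrite (_ : Q * _ = 3 * (t * (s * Q * u)) + 3 * (s * (t * Q) * v)); last by ring.
  rewrite (_ : t * s * Q * u = t * (s * Q * u)) in h4; last by ring.
  by lra.
have {}ES n : E n = 0 by rewrite ES E0 mulr0.
have step n : A n.+2 = a / 2 * A n.+1 /\ (q%:R - a ^+ 2 / 4) * A n.+1 ^+ 2 = 0.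
  have h2 := sqr_ge0 (A n.+2 - a / 2 * A n.+1).
  have h1 : 0 <= (q%:R - a ^+ 2 / 4) * A n.+1 ^+ 2 by rewrite mulr_ge0 ?sqr_ge0.
  have := ES n; rewrite Esq => /eqP; rewrite paddr_eq0 // sqrf_eq0 subr_eq0.
  by case/andP=> /eqP -> /eqP.
(* By [step], [A n.+1 ^+ 2] is exactly [q ^ n * A 1 ^+ 2], so the decay of [b] forces [A 1 = 0].
   Then [A 2] and [A 0] vanish too, and the inhomogeneous equation [A1] fails. *)
have A10 : A 1%N = 0.
  apply/eqP; rewrite -sqrf_eq0 eq_le sqr_ge0 andbT.
  apply: (small _ (q.+1%:R + q.+1%:R)) => n.
  have An : A n.+1 ^+ 2 = q%:R ^+ n * A 1%N ^+ 2.
    elim: n => [|n IHn]; first by rewrite mul1r.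
    have [-> h] := step n; rewrite exprMn [q%:R ^+ n.+1]exprS -mulrA -IHn.
    have -> : (a / 2) ^+ 2 = a ^+ 2 / 4 by field.
    by move: h; rewrite mulrBl => /eqP; rewrite subr_eq0 => /eqP ->.
  have qn : 0 < q%:R ^+ n :> R by rewrite exprn_gt0.
  have h1 := hb n; have h2 := le_trans (sqr_ge0 _) (hb n.+1).
  have b2 : 0 <= b n.+2 by rewrite -(pmulr_rge0 _ (mulr_gt0 q1 (exprn_gt0 n.+1 q0))).
  have : q%:R ^+ n * A 1%N ^+ 2 <= q%:R ^+ n * (q.+1%:R * b n.+1).
    by rewrite -An (le_trans h1) // mulrCA mulrA.
  rewrite ler_pM2l // => h3; apply: le_trans h3 _.
  have b1 : 0 <= b n.+1.
    by rewrite -(pmulr_rge0 _ (mulr_gt0 q1 qn)); apply: le_trans h1; exact: sqr_ge0.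
  by rewrite mulrDl ler_wpDr ?mulr_ge0 ?addr_ge0 ?ler0n // ler_pM2l // lerDl.
have [A20 _] := step 0%N.
have A00 : A 0%N = 0.
  apply: (mulfI (lt0r_neq0 q1)); move: A2; rewrite A20 A10; lra.
by move: q1; have := A1; rewrite A00 A10; lra.
Unshelve. all: by end_near. Qed.

(** Cauchy-Schwarz, from the nonnegativity of the sum of squared deviations from the mean. *)
Lemma sum_sqr_le (I : Type) (r : seq I) (g : I -> R) :
  (\sum_(i <- r) g i) ^+ 2 <= (size r)%:R * \sum_(i <- r) g i ^+ 2.
Proof.
set S := \sum_(i <- r) g i; set B := \sum_(i <- r) _.
have [/size0nil r0|k0] := posnP (size r).
  by rewrite /S /B r0 !big_nil expr0n mulr0.
have k_gt0 : 0 < (size r)%:R :> R by rewrite ltr0n.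
have : 0 <= \sum_(i <- r) (g i - S / (size r)%:R) ^+ 2.
  by apply: sumr_ge0 => i _; exact: sqr_ge0.
under eq_bigr do rewrite sqrrB.
rewrite big_split /= sumrB -/B sumrMnl -mulr_suml -/S big_const_seq count_predT.
rewrite iter_addr_0.
have -> : B - S * (S / (size r)%:R) *+ 2 + (S / (size r)%:R) ^+ 2 *+ size r =
   B - S ^+ 2 / (size r)%:R.
  by rewrite -[_ ^+ 2 *+ _]mulr_natl; field; rewrite gt_eqF.
by rewrite subr_ge0 ler_pdivrMr // mulrC.
Qed.

Variables (T : choiceType) (e : rel T) (o : T).
Hypothesis hT : homogeneous_tree q e.

Lemma big_neighbours (g : T -> R[i]) x :
  \sum_(y \in [set y | e x y]) g y = \sum_(y <- neighbours hT x) g y.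
Proof.
have [u _ me] := neighboursP hT x; rewrite (fsbig_seq _ _ u).
by congr (\sum_(y \in _) g y); apply/seteqP; split=> y /=; rewrite me.
Qed.

Notation sphere := (sphere o hT).

(** The spheres are disjoint, so the partial sums of this series are bounded by the squared norm of
    [f], and its terms tend to 0. *)
Lemma sphere_sums_cvg0 (f : T -> R[i]) : l2 f ->
  (fun n => \sum_(x <- sphere n) (complex.Re `|f x|) ^+ 2) @ \oo --> (0 : R).
Proof.
rewrite /l2 /= => fl2; set b := (b in b @ \oo); apply: cvg_series_cvg_0.
have b0 n : 0 <= b n by apply: sumr_ge0 => x _; exact: sqr_ge0.
apply: nondecreasing_is_cvgn; first exact: nondecreasing_series.
exists (fine (l2norm_sq f)) => _ [N _ <-].
have l20 : (0 <= l2norm_sq f)%E by apply: esum_ge0 => x _; rewrite lee_fin sqr_ge0.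
rewrite -lee_fin fineK ?ge0_fin_numE //.
pose r := flatten [seq sphere n | n <- iota 0 N].
have ur k M : uniq (flatten [seq sphere n | n <- iota k M]).
  elim: M k => [|M IHM] k //=.
  rewrite cat_uniq sphere_uniq IHM andbT /=; apply/hasPn => x /flatten_mapP[m].
  rewrite mem_iota !mem_sphere => /andP[km _] /eqP ->; apply/negP => /eqP; lia.
apply: esum_ge; exists [set` r]; first by split=> //; exact: finite_seq.
rewrite -(fsbig_seq _ _ (ur 0%N N)) sumEFin lee_fin /series /= big_flatten big_map.
by rewrite /index_iota subn0.
Qed.

Lemma l2_dirac : l2 (fun x => (x == o)%:R : R[i]).
Proof.
rewrite /l2 /= /l2norm_sq.
have -> : (\esum_(x in [set: T]) ((complex.Re `|(x == o)%:R : R[i]|) ^+ 2)%:E)%E =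
    (\esum_(x in [set o]) 1%:E)%E :> \bar R.
  rewrite [RHS]esum_mkcond; apply: eq_esum => x _; rewrite in_set1.
  by case: eqP => _; rewrite ?normr1 ?normr0 /= ?expr1n // expr0n.
by rewrite (esum_set1 (a := fun=> 1%:E)) ?ltry ?lee_fin.
Qed.

(** On the segment [l] is real, so the real part [g] of the solution [f] solves the same equation.
    Summing it over a sphere, the children contribute the sum over the next sphere, and the parents
    contribute the previous one with multiplicity [q], or [q + 1] at the root. Cauchy-Schwarz on
    spheres gives the bound required by [radial_not_square_summable]. *)
Lemma spec_outer_domain (l : R[i]) : ~ spec q e l -> outer_domain q l.
Proof.
move=> /contrapT[S [Sl2 ShS _ _]]; apply: contrapT => nO.
pose f := S (fun x => (x == o)%:R); have fl2 : l2 f by apply: Sl2; exact: l2_dirac.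
have Hf x : shifted q e l f x = (x == o)%:R.
  by rewrite /f ShS //; exact: l2_dirac.
have Iml : complex.Im l = 0 by apply/eqP; apply: contra_notT nO; left.
have Rel : q.+1%:R * `|complex.Re l| <= 2 * Num.sqrt q%:R.
  by rewrite leNgt; apply/negP => h; apply: nO; right.
pose a := q.+1%:R * complex.Re l; pose g x := complex.Re (f x).
have ReD : {morph (@complex.Re R) : x y / x + y} by move=> [? ?] [? ?].
have sumg x : \sum_(y <- neighbours hT x) g y = a * g x + q.+1%:R * (x == o)%:R.
  have N0 : q.+1%:R != 0 :> R[i] by rewrite pnatr_eq0.
  have -> : \sum_(y <- neighbours hT x) g y =
     complex.Re (\sum_(y <- neighbours hT x) f y) by rewrite (big_morph _ ReD erefl).
  have := Hf x; rewrite /shifted /transition big_neighbours => /eqP.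
  rewrite subr_eq => /eqP /(congr1 ( *%R q.+1%:R)); rewrite mulVKf // => ->.
  rewrite -[q.+1%:R in LHS](rmorph_nat (real_complex R)) /a /g.
  case: (l) (f x) Iml => [c d] [c' d'] /= ->.
  by case: eqP => _; simpc; rewrite /= ?mulr1n ?mulr0n; ring.
pose A n := \sum_(x <- sphere n) g x.
have sumA n : a * A n + q.+1%:R * (n == 0%N)%:R =
    \sum_(x <- sphere n) \sum_(y <- neighbours hT x) g y.
  under eq_bigr do rewrite sumg.
  rewrite big_split /= -mulr_sumr -mulr_sumr; congr (_ + _ * _).
  case: n => [|n]; first by rewrite /= big_seq1 eqxx.
  rewrite big_seq big1 // => x; rewrite mem_sphere => /eqP lx.
  by case: eqP lx => // ->; rewrite (level_root _ hT).
have AS n : A n.+1 = \sum_(x <- sphere n) \sum_(y <- children o hT x) g y.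
  by rewrite /A /= big_flatten big_map.
have sum_parent n : \sum_(x <- sphere n.+1) g (parent e o x) =
    (if n == 0%N then q.+1%:R else q%:R) * A n.
  rewrite /= big_flatten big_map mulr_sumr; apply: eq_big_seq => x xn.
  transitivity (\sum_(y <- children o hT x) g x).
    apply: eq_big_seq => y; rewrite mem_children => /andP[_ /eqP ->] //.
  rewrite big_const_seq count_predT iter_addr_0 -[_ *+ size _]mulr_natl size_children.
  move: xn; rewrite mem_sphere => /eqP <-.
  case: (eqVneq x o) => [->|xo]; first by rewrite (level_root o hT).
  by case: eqP => // /(level_eq0 hT) xo'; rewrite xo' eqxx in xo.
have A1 : a * A 0%N + q.+1%:R = A 1%N.
  have := sumA 0%N; rewrite eqxx mulr1 => ->; rewrite AS !big_seq1.
  exact: perm_big (perm_neighbours_root _ hT).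
have A2 n : a * A n.+1 = (if n == 0%N then q.+1%:R else q%:R) * A n + A n.+2.
  rewrite -sum_parent (AS n.+1) -big_split /= -[LHS]addr0.
  have := sumA n.+1; rewrite mulr0 => ->; apply: eq_big_seq => x.
  rewrite mem_sphere => /eqP lx.
  have xo : x != o by apply: contra_eq_neq lx => ->; rewrite (level_root _ hT).
  by rewrite (perm_big _ (perm_neighbours hT xo)) big_cons.
apply: (radial_not_square_summable (A := A) _ _ _ _ _ (sphere_sums_cvg0 fl2) (a := a)).
- rewrite -[leRHS](_ : (2 * Num.sqrt q%:R) ^+ 2 = _); last first.
    by rewrite exprMn sqr_sqrtr // -natrX.
  rewrite -[a ^+ 2]real_normK ?num_real // ler_pXn2r ?nnegrE ?normr_ge0 //.
  by rewrite /a normrM ger0_norm.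
- by rewrite A1.
- by rewrite A2 eqxx addrC addKr.
- by move=> n; rewrite A2 /= addrC addKr.
- move=> n; apply: le_trans (sum_sqr_le _ _) _.
  rewrite size_sphere natrM natrX ler_wpM2l ?mulr_ge0 ?exprn_ge0 //.
  apply: ler_sum => x _; rewrite normc_def /= sqr_sqrtr ?addr_ge0 ?sqr_ge0 //.
  by rewrite lerDl sqr_ge0.
Qed.

End Spectrum.

(** * Distributions on the boundary *)

Section Boundary.
Variables (R : realType) (q : nat) (T : choiceType) (e : rel T) (o : T).
Hypothesis hq : (2 <= q)%N.
Hypothesis hT : homogeneous_tree q e.
Notation bd := (boundary e o).
Notation sphere := (sphere o hT).
Notation lev := (level e o).
Implicit Types (sigma : set bd -> R[i]) (xi eta : bd).

Lemma open_arc (x : T) : open (boundary_arc x : set bd).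
Proof.
exists [set boundary_arc x : set bd]; last by rewrite bigcup_set1.
move=> _ ->; exists [fset (boundary_arc x : set bd)]%fset => /=.
  by move=> A; rewrite inE => /eqP ->; apply/mem_set; exists x.
by rewrite set_fset1 bigcap_set1.
Qed.

(** A cylinder is a union of arcs, and its complement is again a cylinder. *)
Lemma clopen_cylinder n (P : T -> Prop) : clopen [set xi : bd | P (sval xi n)].
Proof.
have op (Q : T -> Prop) : open [set xi : bd | Q (sval xi n)].
  rewrite (_ : [set _ | _] = \bigcup_(v in [set v | lev v = n /\ Q v]) boundary_arc v).
    by apply: bigcup_open => v _; exact: open_arc.
  apply/seteqP; split=> [xi /= Qxi|xi [v /= [lv Qv] /boundary_arcE]].
    by exists (sval xi n) => /=; [rewrite (level_ray hT)|exact: boundary_arc_ray].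
  by move=> /(_ _ hT); rewrite lv => ->.
split; first exact: op.
by rewrite -[X in closed X]setCK closedC; exact: (op (fun v => ~ P v)).
Qed.

Lemma arcE v : boundary_arc v = [set xi : bd | sval xi (lev v) = v].
Proof. by apply/funext => xi; apply/propext; exact: (boundary_arcE hT). Qed.

Lemma clopen_arc v : clopen (boundary_arc v : set bd).
Proof. by rewrite arcE; exact: (clopen_cylinder (lev v) (fun u => u = v)). Qed.

(** Around [xi] the set [A] contains a finite intersection of arcs; the largest level of their
    vertices serves as [n]. *)
Lemma open_contains_cylinder (A : set bd) xi : open A -> A xi ->
  exists n, forall eta, sval eta n = sval xi n -> A eta.
Proof.
move=> [D' sD' <-] [B D'B Bxi].
have [F sF BF] := sD' _ D'B.
have Fn (s : seq (set bd)) : {subset s <= F} ->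
    exists n, forall eta, sval eta n = sval xi n -> forall C, C \in s -> C eta.
  elim: s => [|C s IHs] sub; first by exists 0%N.
  have [|n hn] := IHs; first by move=> y ys; apply: sub; rewrite inE ys orbT.
  have CF : C \in F by apply: sub; rewrite inE eqxx.
  have : C xi by move: Bxi; rewrite -BF; apply.
  have /set_mem [x _ Cx] := sF _ CF; rewrite -Cx => /(boundary_arcE hT) xx.
  exists (maxn n (lev x)) => eta E.
  have E' k : (k <= maxn n (lev x))%N -> sval eta k = sval xi k.
    move=> kn; rewrite -(anc_ray hT xi (maxn n (lev x) - k) k).
    by rewrite -(anc_ray hT eta (maxn n (lev x) - k) k) subnK // E.
  move=> C'; rewrite inE => /orP[/eqP ->|]; last by apply: hn; rewrite E' // leq_maxl.
  by apply/(boundary_arcE hT); rewrite E' ?leq_maxr.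
have [n hn] := Fn (enum_fset F) (fun _ => id).
exists n => eta E; exists B => //; change (B eta); rewrite -BF => C CF; exact: hn CF.
Qed.

Section Distribution.
Variable sigma : set bd -> R[i].
Hypothesis dsigma : is_distribution sigma.

Lemma distribution0 : sigma set0 = 0.
Proof.
have := dsigma clopen0 clopen0 (setI0 set0); rewrite setU0 => /eqP.
by rewrite -subr_eq0 opprD addrA subrr sub0r oppr_eq0 => /eqP.
Qed.

Lemma distribution_cylinder n (s : seq T) : uniq s -> {subset s <= sphere n} ->
  sigma [set xi | sval xi n \in s] = \sum_(v <- s) sigma (boundary_arc v).
Proof.
elim: s => [|v s IHs] /=.
  move=> _ _; rewrite big_nil -distribution0; congr sigma.
  by apply/seteqP; split.
move=> /andP[vs us] sub; rewrite big_cons -IHs //; last first.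
  by move=> y ys; apply: sub; rewrite inE ys orbT.
have lv : lev v = n by apply/eqP; rewrite -(mem_sphere o hT) sub ?mem_head.
rewrite arcE lv -dsigma; [|exact: (clopen_cylinder n (fun u => u = v))|
  exact: (clopen_cylinder n (fun u => u \in s))|].
  congr sigma; apply/seteqP; split=> xi /=; rewrite inE.
    by case/orP => [/eqP|]; [left|right].
  by case=> [->|->]; rewrite ?eqxx ?orbT.
by apply/seteqP; split=> xi //= [->]; rewrite (negbTE vs).
Qed.

Lemma distribution_children v :
  sigma (boundary_arc v) = \sum_(y <- children o hT v) sigma (boundary_arc y).
Proof.
rewrite -(@distribution_cylinder (lev v).+1) ?children_uniq //; last first.
  by move=> y; rewrite mem_children mem_sphere => /(is_childP o hT v y)[_ ->].
congr sigma; apply/seteqP; split=> xi.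
  move=> /(boundary_arcE hT) xv /=; rewrite mem_children /is_child.
  rewrite (parent_ray hT) xv eqxx andbT; apply/eqP => E.
  by have := level_ray hT xi (lev v).+1; rewrite E (level_root o hT).
rewrite /= mem_children => /andP[_]; rewrite (parent_ray hT) => /eqP xv.
by apply/(boundary_arcE hT).
Qed.

(** The level sets of [g] are unions of arcs of level [n], over which finite additivity applies; the
    vertices are then regrouped by their value under [G]. *)
Lemma dist_integral_sphere n (g : bd -> R[i]) (G : T -> R[i]) :
  (forall xi, g xi = G (sval xi n)) ->
  dist_integral sigma g = \sum_(v <- sphere n) G v * sigma (boundary_arc v).
Proof.
move=> gG; rewrite /dist_integral.
pose V := undup [seq G v | v <- sphere n].
have gV xi : g xi \in V by rewrite mem_undup gG; apply: map_f; exact: ray_in_sphere.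
(* The sum is extended to all values of [G] on the sphere: a value not taken by [g] has empty
   preimage, of mass 0. *)
rewrite (fsbig_widen (range g) [set` V]); last first.
- move=> c /= [_ ngc]; rewrite (_ : g @^-1` [set c] = set0) ?distribution0 ?mulr0 //.
  by apply/seteqP; split=> // xi /= gc; apply: ngc; exists xi.
- by move=> _ [xi _ <-] /=; exact: gV.
rewrite -(fsbig_seq _ _ (undup_uniq _)) -/V.
have pre c : c * sigma (g @^-1` [set c]) =
    \sum_(v <- sphere n | G v == c) G v * sigma (boundary_arc v).
  rewrite (_ : g @^-1` [set c] =
     [set xi | sval xi n \in [seq v <- sphere n | G v == c]]).
    rewrite distribution_cylinder ?filter_uniq ?sphere_uniq //; last first.
      by move=> v; rewrite mem_filter => /andP[].
    by rewrite big_filter mulr_sumr; apply: eq_bigr => v /eqP ->.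
  apply/seteqP; split=> xi /=; rewrite gG mem_filter ray_in_sphere andbT.
    by move=> ->.
  by move=> /eqP.
under eq_bigr do rewrite pre big_mkcond.
rewrite exchange_big /=; apply: eq_big_seq => v vn.
rewrite (bigD1_seq (G v)) ?undup_uniq //=; last by rewrite mem_undup; apply: map_f.
by rewrite eqxx big1 ?addr0 // => c; rewrite eq_sym => /negbTE ->.
Qed.

End Distribution.

Definition cylindrical n (g : bd -> R[i]) : Prop :=
  forall xi eta, sval xi n = sval eta n -> g xi = g eta.

Lemma cylindricalP n (g : bd -> R[i]) : cylindrical n g ->
  exists G : T -> R[i], forall xi, g xi = G (sval xi n).
Proof.
move=> cg; exists (fun v => if pselect (exists xi : bd, sval xi n = v) is left ex
  then g (sval (cid ex)) else 0).
move=> xi; case: pselect => [ex|[]]; last by exists xi.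
by apply: cg; case: (cid ex) => /= eta ->.
Qed.

Lemma dist_integral_linear sigma n (a : R[i]) (g h : bd -> R[i]) :
  is_distribution sigma -> cylindrical n g -> cylindrical n h ->
  dist_integral sigma (fun xi => a * g xi + h xi) =
  a * dist_integral sigma g + dist_integral sigma h.
Proof.
move=> ds /cylindricalP[G gG] /cylindricalP[H hH].
rewrite (dist_integral_sphere ds gG) (dist_integral_sphere ds hH).
rewrite (@dist_integral_sphere _ ds n _ (fun v => a * G v + H v)); last first.
  by move=> xi; rewrite gG hH.
by rewrite mulr_sumr -big_split /=; apply: eq_bigr => v _; rewrite mulrDl mulrA.
Qed.

Lemma dist_integral_sum sigma n (I : Type) (s : seq I) (g : I -> bd -> R[i]) :
  is_distribution sigma -> (forall i, cylindrical n (g i)) ->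
  dist_integral sigma (fun xi => \sum_(i <- s) g i xi) =
  \sum_(i <- s) dist_integral sigma (g i).
Proof.
move=> ds cg; elim: s => [|i s IHs].
  rewrite big_nil (@dist_integral_sphere _ ds n _ (fun=> 0)) => [|xi]; last by rewrite big_nil.
  by rewrite big1 // => v _; rewrite mul0r.
rewrite big_cons -IHs -[X in X + _]mul1r -(@dist_integral_linear _ n) //; last first.
  by move=> xi eta E; apply: eq_bigr => j _; exact: cg.
by congr dist_integral; apply/funext => xi; rewrite big_cons mul1r.
Qed.

Lemma dist_integral_distD (sigma tau : set bd -> R[i]) n (a : R[i]) (g : bd -> R[i]) :
  is_distribution sigma -> is_distribution tau -> cylindrical n g ->
  is_distribution (fun A => a * sigma A + tau A) /\
  dist_integral (fun A => a * sigma A + tau A) g =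
  a * dist_integral sigma g + dist_integral tau g.
Proof.
move=> ds dt /cylindricalP[G gG].
have dst : is_distribution (fun A => a * sigma A + tau A).
  by move=> A B cA cB AB; rewrite ds // dt //; ring.
split=> //; rewrite !(dist_integral_sphere _ gG) // mulr_sumr -big_split /=.
by apply: eq_bigr => v _; ring.
Qed.

(** Dependent choice: a child satisfying [P] is selected at each step, starting from the root. *)
Lemma exists_ray_of (P : T -> Prop) : P o ->
  (forall v, P v -> exists2 y, is_child e o v y & P y) ->
  exists xi : bd, forall n, P (sval xi n).
Proof.
move=> Po PS; pose next v := xget v [set y | is_child e o v y /\ P y].
have nextP v : P v -> is_child e o v (next v) /\ P (next v).
  move=> /PS[y cy Py]; rewrite /next; case: xgetP => [z _ //|/(_ y)].
  by case; split.
pose u n := iter n next o.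
have Pu n : P (u n) by elim: n => [|n /nextP[]].
have ru : is_ray e o u.
  by apply: (is_ray_parent hT) => // n; have [] := nextP _ (Pu n).
by exists (exist _ u ru).
Qed.

Lemma boundary_inhabited : exists xi : bd, True.
Proof.
have [v _|xi _] := @exists_ray_of (fun=> True) I; last by exists xi.
have := size_children o hT v.
case cv : (children o hT v) => [|y s]; first by case: ifP => _ /=; lia.
by move=> _; exists y => //; rewrite -(mem_children o hT) cv mem_head.
Qed.

(* If [sigma A] were nonzero, additivity would produce a ray [xi] such that
   [A] has nonzero mass in every arc around [xi]; but small arcs around [xi]
   lie inside [A] or inside its complement. *)
Lemma distribution_eq0 sigma : is_distribution sigma ->
  (forall v, sigma (boundary_arc v) = 0) -> forall A, clopen A -> sigma A = 0.
Proof.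
move=> ds s0 A cA; apply/eqP/negP => /negP sA.
pose mu B := sigma (A `&` B).
have dmu : is_distribution mu.
  move=> B C cB cC BC; rewrite /mu setIUr ds //; try exact: clopenI.
  by rewrite setIACA BC setI0.
have arco : boundary_arc o = setT :> set bd.
  apply/seteqP; split=> // xi _; apply/(boundary_arcE hT).
  by rewrite (level_root o hT) ray0.
have [||xi muxi] := @exists_ray_of (fun v => mu (boundary_arc v) != 0).
- by rewrite /mu arco setIT.
- move=> v muv; apply: contrapT => nex; case/negP: muv.
  rewrite (distribution_children dmu) big_seq big1 // => y.
  rewrite mem_children => cy; apply/eqP/negP => /negP muy; apply: nex.
  by exists y.
have arcxi n : boundary_arc (sval xi n) = [set eta : bd | sval eta n = sval xi n].
  by rewrite arcE (level_ray hT).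
have [Axi|Axi] := pselect (A xi).
  have [n hn] := open_contains_cylinder (proj1 cA) Axi.
  have := muxi n; rewrite /mu (setIidr _) ?s0 ?eqxx //.
  by rewrite arcxi => eta; exact: hn.
have [n hn] := open_contains_cylinder (closed_openC (proj2 cA)) Axi.
have := muxi n; rewrite /mu (_ : _ `&` _ = set0) ?distribution0 ?eqxx //.
by rewrite arcxi; apply/seteqP; split=> // eta [Aeta /hn].
Qed.

End Boundary.

(** * Poisson transforms and uniqueness of the representing distributions *)

Section PoissonTransform.
Variables (R : realType) (q : nat) (T : choiceType) (e : rel T) (o : T).
Hypothesis hq : (2 <= q)%N.
Hypothesis hT : homogeneous_tree q e.
Variable l : R[i].
Hypothesis hl : outer_domain q l.
Notation bd := (boundary e o).
Notation sphere := (sphere o hT).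
Notation lev := (level e o).
Notation PT := (poisson_transform q l).
Notation kappa := (kernel_coeff q).
Implicit Types (sigma tau : set bd -> R[i]) (xi eta : bd).

Lemma poisson_transformE j sigma x :
  PT j sigma x = dist_integral sigma (fun xi => kappa j (horocycle x xi) l).
Proof.
rewrite /poisson_transform; congr dist_integral.
by apply/funext => xi; rewrite poisson_kernel_nE.
Qed.

Lemma cylindrical_kernel j x n : (lev x <= n)%N ->
  cylindrical n (fun xi : bd => kappa j (horocycle x xi) l).
Proof. by move=> xn xi eta E; rewrite (horocycle_same_arc hT xn E). Qed.

Lemma poisson_transform_linear j (a : R[i]) sigma tau :
  is_distribution sigma -> is_distribution tau ->
  PT j (fun A => a * sigma A + tau A) = fun x => a * PT j sigma x + PT j tau x.
Proof.
move=> ds dt; apply/funext => x; rewrite !poisson_transformE.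
by have [_ ->] := dist_integral_distD hT a ds dt (cylindrical_kernel j (leqnn (lev x))).
Qed.

Lemma poisson_transform_eq0 j sigma : is_distribution sigma ->
  (forall A, clopen A -> sigma A = 0) -> PT j sigma = fun=> 0.
Proof.
move=> ds s0; apply/funext => x; rewrite poisson_transformE.
have [G gG] := cylindricalP (cylindrical_kernel j (leqnn (lev x))).
rewrite (dist_integral_sphere hT ds gG) big1 // => v _.
by rewrite s0 ?mulr0 //; exact: (clopen_arc o hT).
Qed.

(** The recurrence of [kernel_coeff], summed over the neighbours of [x] and integrated against
    [sigma]. For [j = 0] the right side is 0, whatever [j.-1] means. *)
Lemma shifted_poisson_transform j sigma : is_distribution sigma ->
  shifted q e l (PT j sigma) = fun x => j%:R * PT j.-1 sigma x.
Proof.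
move=> ds; apply/funext => x; rewrite /shifted /transition (big_neighbours hT).
have N0 : q.+1%:R != 0 :> R[i] by rewrite pnatr_eq0.
apply: (mulfI N0); rewrite mulrBr mulVKf // !poisson_transformE.
have [u sz mn] := neighboursP hT x; pose n := (lev x).+1.
have cyl i y : y \in neighbours hT x ->
    cylindrical n (fun xi : bd => kappa i (horocycle y xi) l).
  by rewrite mn => /(level_edge o hT) ly; exact: cylindrical_kernel.
have cx i : cylindrical n (fun xi : bd => kappa i (horocycle x xi) l).
  exact: cylindrical_kernel.
(* Setting [g y] to 0 away from the neighbours makes every member of the family cylindrical at the
   common level [n], as [dist_integral_sum] requires. *)
pose g y : bd -> R[i] := if y \in neighbours hT x
  then fun xi => kappa j (horocycle y xi) l else fun=> 0.
have -> : \sum_(y <- neighbours hT x) PT j sigma y =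
    dist_integral sigma (fun xi => \sum_(y <- neighbours hT x) g y xi).
  rewrite (dist_integral_sum (n := n) hT) //; last first.
    by move=> y; rewrite /g; case: ifP => [/cyl //|_ ? ? _].
  by apply: eq_big_seq => y yn; rewrite poisson_transformE /g yn.
(* The final [+ 0] gives the shape for two successive uses of [dist_integral_linear]. *)
have -> : (fun xi : bd => \sum_(y <- neighbours hT x) g y xi) = fun xi =>
    q.+1%:R * l * kappa j (horocycle x xi) l +
    (q.+1%:R * j%:R * kappa j.-1 (horocycle x xi) l + 0).
  apply/funext => xi; have [y0 ey0 [hy0 hy]] := horocycle_next hT x xi.
  transitivity (\sum_(y <- neighbours hT x) kappa j (horocycle y xi) l).
    by apply: eq_big_seq => y yn; rewrite /g yn.
  have y0n : y0 \in neighbours hT x by rewrite mn.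
  rewrite (bigD1_seq y0) //= hy0 -big_filter.
  rewrite (eq_big_seq (fun=> kappa j (horocycle x xi - 1) l)); last first.
    by move=> y; rewrite mem_filter mn => /andP[yy0 exy]; rewrite hy.
  rewrite big_const_seq count_predT iter_addr_0 size_filter.
  have -> : count (fun y => y != y0) (neighbours hT x) = q.
    have := count_predC (pred1 y0) (neighbours hT x).
    by rewrite sz count_uniq_mem // y0n add1n => -[].
  rewrite -[_ *+ q]mulr_natl (kernel_coeff_recurrence hq) // addr0; ring.
rewrite (dist_integral_linear hT (n := n)) //; last first.
  by move=> xi eta E; congr (_ * _ + _); exact: cx.
rewrite (dist_integral_linear hT (n := n)) //.
have -> : dist_integral sigma (fun=> 0 : R[i]) = 0.
  rewrite (dist_integral_sphere hT ds (n := 0) (G := fun=> 0)) //.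
  by rewrite big1 // => v _; rewrite mul0r.
ring.
Qed.

(** At the root the kernel is 1, which gives the total mass. For another [v], subtracting [w^-1]
    times the kernel at the parent leaves a function carried by the arc of [v] with constant value
    [d = w ^ n * (1 - w ^- 2)], nonzero because [|w| > 1]. [distribution_eq0] then passes from arcs
    to clopen sets. *)
Lemma poisson_transform_inj sigma : is_distribution sigma ->
  (forall x, PT 0 sigma x = 0) -> forall A, clopen A -> sigma A = 0.
Proof.
move=> ds P0; apply: (distribution_eq0 hT ds) => v.
pose w := qpow q (zeta q l).
have w1 : 1 < `|w| by exact: (branch_norm_gt1 hq hl).
have w0 : w != 0 by rewrite -normr_gt0 (lt_trans _ w1).
have [->|vo] := eqVneq v o.
  have := P0 o; rewrite poisson_transformE.
  rewrite (dist_integral_sphere hT ds (n := 0) (G := fun=> 1)).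
    by rewrite /= big_seq1 mul1r.
  by move=> xi; have := horocycle_on_ray hT xi 0; rewrite ray0 => ->.
have [_ lp] := parentP hT vo.
pose n := lev v; pose d := w ^ n%:Z - w^-1 * w ^ (n%:Z - 1).
have cv : cylindrical n (fun xi : bd => kappa 0 (horocycle v xi) l).
  exact: cylindrical_kernel.
have cp : cylindrical n (fun xi : bd => kappa 0 (horocycle (parent e o v) xi) l).
  by apply: cylindrical_kernel; rewrite /n -lp.
have : dist_integral sigma (fun xi => - w^-1 * kappa 0 (horocycle (parent e o v) xi) l
    + kappa 0 (horocycle v xi) l) = 0.
  rewrite (dist_integral_linear hT (n := n)) // -!poisson_transformE !P0.
  by rewrite mulr0 addr0.
rewrite (dist_integral_sphere hT ds (n := n) (G := fun u => if u == v then d else 0)).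
  rewrite (bigD1_seq v) ?sphere_uniq ?mem_sphere //= eqxx big1 ?addr0; last first.
    by move=> u /negbTE ->; rewrite mul0r.
  move=> /eqP; rewrite mulf_eq0 => /orP[/eqP d0|/eqP //].
  exfalso; have : w ^ n%:Z * (1 - w^-1 ^+ 2) = 0.
    rewrite -d0 /d expfzDr // exprN1; ring.
  move=> /eqP; rewrite mulf_eq0 expfz_eq0 (negbTE w0) andbF /= subr_eq0 => /eqP.
  move=> /(congr1 Num.norm); rewrite normr1 normrX normfV => E.
  have : `|w|^-1 ^+ 2 < 1 by rewrite exprn_ilt1 // ?invr_ge0 // invf_lt1 // (lt_trans _ w1).
  by rewrite -E ltxx.
move=> xi; rewrite !kernel_coeff0 -/w; case: eqP => [xv|/eqP xv].
  have hv : horocycle v xi = n%:Z by rewrite -{1}xv (horocycle_on_ray hT).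
  have pv : parent e o v = sval xi (lev (parent e o v)).
    by rewrite -(parent_ray hT) lp xv.
  have -> : horocycle (parent e o v) xi = n%:Z - 1.
    by rewrite {1}pv (horocycle_on_ray hT) /n -lp; lia.
  by rewrite hv /d mulNr addrC.
rewrite (horocycle_off_ray hT xv); move: (horocycle (parent e o v) xi) => h.
by rewrite expfzDr // exprN1; ring.
Qed.

End PoissonTransform.

(* Unqualified, [total_variation] is the variation of a real function. *)
Local Notation measure_norm := Defs.total_variation.

(** * The total variation of distributions *)

Section MeasureNorm.
Variables (R : realType) (T : choiceType) (e : rel T) (o : T).
Notation bd := (boundary e o).
Implicit Types (sigma tau : set bd -> R[i]).

Lemma Re_norm_ge0 (z : R[i]) : 0 <= complex.Re `|z|.
Proof. by rewrite normc_def /= sqrtr_ge0. Qed.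

Lemma measure_norm_ge0 sigma : (0 <= measure_norm sigma)%E.
Proof.
apply: (@le_trans _ _ (\sum_(i < 1) complex.Re `|sigma setT|)%:E).
  by rewrite lee_fin sumr_ge0 // => i _; exact: Re_norm_ge0.
apply: ereal_sup_ubound; exists 1%N, (fun=> setT); split=> //.
- by move=> i; exact: clopenT.
- by move=> i j _ _ _; rewrite (ord1 i) (ord1 j).
- by apply/seteqP; split=> // xi _; exists ord0.
Qed.

Lemma measure_norm_eq sigma tau :
  (forall A, clopen A -> sigma A = tau A) ->
  measure_norm sigma = measure_norm tau.
Proof.
move=> st; congr ereal_sup; apply/seteqP; split=> r [n [A [cA tA UA ->]]];
  by exists n, A; split=> //; congr EFin; apply: eq_bigr => i _; rewrite st.
Qed.

Lemma measure_norm0 : measure_norm (fun _ : set bd => 0 : R[i]) = 0%E.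
Proof.
apply/eqP; rewrite eq_le measure_norm_ge0 andbT; apply: ge_ereal_sup.
move=> r [n [A [_ _ _ ->]]]; rewrite lee_fin big1 // => i _.
by rewrite normr0.
Qed.

Lemma measure_norm_natmul_le sigma n :
  (measure_norm (fun A => (n.+1%:R : R[i]) * sigma A)%R <=
   n.+1%:R%:E * measure_norm sigma)%E.
Proof.
apply: ge_ereal_sup => r [k [A [cA tA UA ->]]].
have -> : (\sum_(i < k) complex.Re `|(n.+1%:R : R[i]) * sigma (A i)|)%:E =
    (n.+1%:R%:E * (\sum_(i < k) complex.Re `|sigma (A i)|)%:E)%E.
  rewrite -EFinM mulr_sumr; congr EFin; apply: eq_bigr => i _.
  rewrite normrM normr_nat -(rmorph_nat (real_complex R)).
  by rewrite normc_def; simpc.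
rewrite lee_pmul2l ?lte_fin ?ltr0Sn //.
by apply: ereal_sup_ubound; exists k, A; split.
Qed.

End MeasureNorm.

(** * Uniqueness of representing families and the contraction property *)

Section Representation.
Variables (R : realType) (q : nat) (T : choiceType) (e : rel T) (o : T).
Hypothesis hq : (2 <= q)%N.
Hypothesis hT : homogeneous_tree q e.
Variable l : R[i].
Hypothesis hl : outer_domain q l.
Notation bd := (boundary e o).
Notation PT := (poisson_transform q l).
Implicit Types (f : T -> R[i]) (sigma tau : nat -> set bd -> R[i]).

(** Families indexed by all naturals and zero from [m] on can be shifted and compared across
    different lengths. Unlike in [represents], the sum has [m] terms, so that induction can start
    from the empty one. *)
Definition finite_rep f m sigma : Prop :=
  [/\ forall j, is_distribution (sigma j),
      forall j, (m <= j)%N -> sigma j = fun=> 0 &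
      forall x, f x = \sum_(j < m) PT j (sigma j) x].

Lemma distribution_zero : is_distribution (fun _ : set bd => 0 : R[i]).
Proof. by move=> A B _ _ _; rewrite addr0. Qed.

Lemma shifted_sum m (F : nat -> T -> R[i]) x :
  shifted q e l (fun y => \sum_(j < m) F j y) x =
  \sum_(j < m) shifted q e l (F j) x.
Proof.
rewrite /shifted /transition (big_neighbours hT) exchange_big /= sumrB.
rewrite -!mulr_sumr; congr (_ * _ - _).
by apply: eq_bigr => j _; rewrite (big_neighbours hT).
Qed.

(** The length [m] is kept: the new last coefficient is a multiple of [sigma m], hence zero. *)
Lemma finite_rep_shifted f m sigma : finite_rep f m sigma ->
  finite_rep (shifted q e l f) m (fun j A => j.+1%:R * sigma j.+1 A).
Proof.
move=> [ds s0 fE]; split.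
- by move=> j A B cA cB AB; rewrite (ds j.+1 A B) // mulrDr.
- by move=> j mj; rewrite s0 ?(leq_trans mj) //; apply/funext => A; rewrite mulr0.
move=> x; have -> : f = fun x => \sum_(j < m) PT j (sigma j) x by apply/funext.
rewrite (shifted_sum m (fun j => PT j (sigma j))) /=.
under eq_bigr do rewrite (shifted_poisson_transform hq hT hl) //.
have E j : j.+1%:R * PT j (sigma j.+1) x = PT j (fun A => j.+1%:R * sigma j.+1 A) x.
  have := @poisson_transform_linear R q T e o hT l j j.+1%:R _ _ (ds j.+1) distribution_zero.
  under eq_fun do rewrite addr0; move=> ->.
  by rewrite (poisson_transform_eq0 hT l j distribution_zero) // addr0.
case: m {fE} s0 => [|m] s0; first by rewrite !big_ord0.
rewrite big_ord_recl mul0r add0r [RHS]big_ord_recr /=.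
rewrite -(E m) s0 // (poisson_transform_eq0 hT l m distribution_zero) // mulr0 addr0.
by apply: eq_bigr => j _; rewrite -E /bump leq0n add1n.
Qed.

(** Applying [P - l] discards [sigma 0] and shortens the family, so by induction the higher
    coefficients vanish; [poisson_transform_inj] then deals with [sigma 0]. *)
Lemma finite_rep_eq0 m sigma : finite_rep (fun=> 0) m sigma ->
  forall j A, clopen A -> sigma j A = 0.
Proof.
elim: m sigma => [|m IHm] sigma rep.
  by case: rep => _ s0 _ j A _; rewrite s0.
have [ds s0 fE] := rep.
have sS j A : clopen A -> sigma j.+1 A = 0.
  move=> cA; have := finite_rep_shifted rep.
  rewrite (_ : shifted q e l (fun=> 0) = fun=> 0); last first.
    apply/funext => x; rewrite /shifted /transition (big_neighbours hT).
    by rewrite big1 // !mulr0 subr0.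
  move=> [ds' s0' fE'].
  have rep' : finite_rep (fun=> 0) m (fun j A => j.+1%:R * sigma j.+1 A).
    split=> // [k mk|x]; first by rewrite s0 //; apply/funext => B; rewrite mulr0.
    apply: etrans (fE' x) _; rewrite big_ord_recr /=.
    rewrite (poisson_transform_eq0 hT l m (ds' m)) ?addr0 // => B _.
    by rewrite s0 ?mulr0.
  have /eqP := IHm _ rep' j A cA; rewrite mulf_eq0 pnatr_eq0 /= => /eqP //.
move=> [|j] A cA; last exact: sS.
apply: (poisson_transform_inj hq hT hl (ds 0%N)) => // x.
have := fE x; rewrite big_ord_recl big1 ?addr0 // => j _.
by rewrite (poisson_transform_eq0 hT l _ (ds _)) // => B cB; exact: sS.
Qed.

Lemma finite_rep_widen f m n sigma : (m <= n)%N ->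
  finite_rep f m sigma -> finite_rep f n sigma.
Proof.
move=> mn [ds s0 fE]; split=> // [j nj|x]; first by rewrite s0 // (leq_trans mn).
rewrite fE (big_ord_widen n (fun j => PT j (sigma j) x)) // big_mkcond /=.
apply: eq_bigr => j _; case: ltnP => // mj.
by rewrite s0 // (poisson_transform_eq0 hT l j distribution_zero).
Qed.

Definition weighted_variation m sigma : \bar R :=
  (\sum_(j < m) (j`!)%:R%:E * measure_norm (sigma j))%E.

Lemma weighted_variation_widen m n sigma : (m <= n)%N ->
  (forall j, (m <= j)%N -> sigma j = fun=> 0) ->
  weighted_variation n sigma = weighted_variation m sigma.
Proof.
move=> mn s0; rewrite /weighted_variation.
rewrite [RHS](big_ord_widen n (fun j => (j`!)%:R%:E * measure_norm (sigma j))%E) //.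
rewrite [RHS]big_mkcond /=; apply: eq_bigr => j _; case: ltnP => // mj.
by rewrite s0 // measure_norm0 mule0.
Qed.

(** The difference of the two families represents 0, so they agree on clopen sets, which are all
    that the variation sees. *)
Lemma weighted_variation_unique f m n sigma tau :
  finite_rep f m sigma -> finite_rep f n tau ->
  weighted_variation m sigma = weighted_variation n tau.
Proof.
move=> rs rt; have [_ s0 _] := rs; have [_ t0 _] := rt.
have /(finite_rep_widen (leq_maxl m n)) [ds _ sE] := rs.
have /(finite_rep_widen (leq_maxr m n)) [dt _ tE] := rt.
rewrite -(weighted_variation_widen (leq_maxl m n) s0).
rewrite -(weighted_variation_widen (leq_maxr m n) t0).
apply: eq_bigr => j _; congr (_ * _)%E; apply: measure_norm_eq => A cA.
have rep : finite_rep (fun=> 0) (maxn m n) (fun j A => (-1) * sigma j A + tau j A).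
  split.
  (* [dist_integral_distD] asks for some cylindrical function; the kernel at [o] serves as one. *)
  - by move=> k; have [] := dist_integral_distD hT (-1) (ds k) (dt k) (cylindrical_kernel hT l 0 (leqnn (level e o o))).
  - move=> k; rewrite geq_max => /andP[mk nk]; rewrite s0 // t0 //.
    by apply/funext => B; rewrite mulr0 addr0.
  - move=> x; under eq_bigr do rewrite (poisson_transform_linear hT) //.
    by rewrite big_split /= -mulr_sumr -sE -tE mulN1r addNr.
have /eqP := finite_rep_eq0 rep j cA.
by rewrite mulN1r addrC subr_eq0 => /eqP.
Qed.

Definition extend_zero m (sigma : 'I_m -> set bd -> R[i]) (j : nat) : set bd -> R[i] :=
  if insub j is Some i then sigma i else fun=> 0.

Lemma extend_zeroE m (sigma : 'I_m -> set bd -> R[i]) (i : 'I_m) :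
  extend_zero sigma i = sigma i.
Proof. by rewrite /extend_zero valK. Qed.

Lemma finite_rep_represents f m (sigma : 'I_m.+1 -> set bd -> R[i]) :
  represents q l f sigma -> finite_rep f m.+1 (extend_zero sigma).
Proof.
move=> [ds ->]; split.
- by move=> j; rewrite /extend_zero; case: insubP => [i _ _|_]; [exact: ds|exact: distribution_zero].
- by move=> j mj; rewrite /extend_zero insubF // ltnNge mj.
- by move=> x; apply: eq_bigr => j _; rewrite extend_zeroE.
Qed.

Lemma poly_norm_finite_rep f m sigma : finite_rep f m.+1 sigma ->
  poly_norm q e o l f = weighted_variation m.+1 sigma.
Proof.
move=> rep; have [ds s0 fE] := rep; rewrite /poly_norm; case: xgetP.
  move=> r -> [n [tau [/finite_rep_represents rt ->]]].
  rewrite (weighted_variation_unique rep rt).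
  by apply: eq_bigr => j _; rewrite extend_zeroE.
move=> /(_ (weighted_variation m.+1 sigma)) [].
exists m, (fun j => sigma j); split=> //; split=> //; exact/funext.
Qed.

(** Finiteness of the norm rules out the default [+oo] of [poly_norm], so a representation
    exists. *)
Lemma polyharm_space_rep f : polyharm_space q e o l f ->
  exists m sigma, finite_rep f m.+1 sigma.
Proof.
move=> [_]; rewrite /poly_norm; case: xgetP => [r -> [m [sigma [rs _]]] _|_]; last first.
  by rewrite ltxx.
by exists m, (extend_zero sigma); exact: finite_rep_represents.
Qed.

Lemma poly_norm_ge0 f : polyharm_space q e o l f -> (0 <= poly_norm q e o l f)%E.
Proof.
move=> /polyharm_space_rep[m [sigma /poly_norm_finite_rep ->]].
apply: sume_ge0 => j _; rewrite mule_ge0 ?measure_norm_ge0 //.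
Qed.

(** Since [j! (j + 1) = (j + 1)!], the weighted variation of the shifted family is at most the
    original one without its term of degree 0. *)
Lemma shifted_contraction f : polyharm_space q e o l f ->
  polyharm_space q e o l (shifted q e l f) /\
  (poly_norm q e o l (shifted q e l f) <= poly_norm q e o l f)%E.
Proof.
move=> Hf; have [m [sigma rep]] := polyharm_space_rep Hf.
have [[n fn] flt] := Hf.
suff le : (poly_norm q e o l (shifted q e l f) <= poly_norm q e o l f)%E.
  split=> //; split; last exact: le_lt_trans flt.
  exists n; rewrite -iterSr iterS fn; apply/funext => x.
  by rewrite /shifted /transition (big_neighbours hT) big1 // !mulr0 subr0.
rewrite (poly_norm_finite_rep rep) (poly_norm_finite_rep (finite_rep_shifted rep)).
have [_ s0 _] := rep.
rewrite -(weighted_variation_widen (leqnSn m.+1) s0).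
rewrite /weighted_variation [leRHS]big_ord_recl -[leLHS]add0e leeD //.
  by rewrite mule_ge0 ?measure_norm_ge0.
apply: lee_sum => j _ /=; rewrite /bump leq0n add1n factS natrM mulrC EFinM -muleA.
by rewrite lee_wpmul2l ?lee_fin ?ler0n // measure_norm_natmul_le.
Qed.

(** The Poisson transform of the Dirac mass at a boundary point. It shows that the completion is not
    the zero space, where every orbit would be dense. *)
Lemma exists_unit_polyharmonic :
  exists2 f, polyharm_space q e o l f & poly_norm q e o l f = 1%E.
Proof.
have [xi _] := boundary_inhabited o hq hT.
pose d (A : set bd) : R[i] := (xi \in A)%:R.
have dE B : complex.Re `|d B| = (xi \in B)%:R.
  by rewrite /d; case: (xi \in B); rewrite ?normr1 ?normr0.
have dd : is_distribution d.
  move=> A B _ _ AB; rewrite /d in_setU.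
  case: (boolP (xi \in A)) => [xA|_]; case: (boolP (xi \in B)) => [xB|_]; rewrite ?addr0 ?add0r //.
  have : (A `&` B) xi by split; exact: set_mem.
  by rewrite AB.
pose sigma j : set bd -> R[i] := if j is 0%N then d else fun=> 0.
have rep : finite_rep (PT 0 d) 1 sigma.
  split=> [[|j]|[|j]|x] //; first exact: distribution_zero.
  by rewrite big_ord_recl big_ord0 addr0.
have N1 : poly_norm q e o l (PT 0 d) = 1%E.
  rewrite (poly_norm_finite_rep rep) /weighted_variation big_ord_recl big_ord0 adde0 mul1e.
  apply/eqP; rewrite eq_le; apply/andP; split.
    apply: ge_ereal_sup => r [n [A [_ tA UA ->]]]; rewrite lee_fin.
    have [i _ Ai] : (\bigcup_i A i) xi by rewrite UA.
    rewrite (eq_bigr (fun j => (xi \in A j)%:R)) => [|j _]; last exact: dE.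
    rewrite (bigD1 i) //= mem_set // big1 ?addr0 // => j ji.
    case: (boolP (xi \in A j)) => [|//].
    move=> /set_mem Aj; have /eqP := tA i j I I (ex_intro _ xi (conj Ai Aj)).
    by rewrite eq_sym (negbTE ji).
  apply: ereal_sup_ubound; exists 1%N, (fun=> setT); split=> //.
  - by move=> i; exact: clopenT.
  - by move=> i j _ _ _; rewrite (ord1 i) (ord1 j).
  - by apply/seteqP; split=> // eta _; exists ord0.
  - by rewrite big_ord_recl big_ord0 addr0 dE in_setT.
exists (PT 0 d) => //; split; last by rewrite N1 ltry.
exists 1%N => /=; apply/funext => x; have [_ _ E] := finite_rep_shifted rep.
rewrite E big_ord_recl big_ord0 addr0.
by rewrite (poisson_transform_eq0 hT l 0) // => [A B|A] *; rewrite /= !mulr0 ?addr0.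
Qed.

End Representation.

(** * Contractions are not hypercyclic *)

Section Hypercyclicity.
Variables (K : numFieldType) (Y : normedModType K) (U : Y -> Y).
Hypothesis contr : forall y, `|U y| <= `|y|.

(** The orbit of [g] stays in the ball of radius [|g|], and so misses the unit ball around a
    multiple of [y0] of norm [|g| + 1]. *)
Lemma contraction_not_hypercyclic (y0 : Y) : y0 != 0 -> ~ hypercyclic U.
Proof.
move=> y00 [g dg].
have orb n : `|iter n U g| <= `|g|.
  by elim: n => [|n IHn] //=; exact: le_trans (contr _) IHn.
pose y : Y := ((`|g| + 1) / `|y0|) *: y0.
have ny : `|y| = `|g| + 1.
  by rewrite normrZ normrM normfV normr_id divfK ?normr_eq0 // ger0_norm // addr_ge0.
have [||z []] := dg (ball y 1).
- by exists y; apply: ballxx.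
- exact: ball_open.
rewrite -ball_normE /= => yz [n _ nz]; rewrite -nz in yz.
have := ler_normD (y - iter n U g) (iter n U g); rewrite subrK ny => le.
have : `|y - iter n U g| + `|iter n U g| < `|g| + 1.
  by rewrite addrC ler_ltD.
by move=> /(le_lt_trans le); rewrite ltxx.
Qed.

End Hypercyclicity.

(** * Passage to the completion *)

Lemma dense_contraction (R : realType) (Y : normedModType R[i]) (U : Y -> Y)
    (S : set Y) :
  continuous U -> dense S -> (forall y, S y -> `|U y| <= `|y|) ->
  forall y, `|U y| <= `|y|.
Proof.
move=> cU dS US y; apply/ler_addgt0Pr => eps eps0.
have e2 : 0 < eps / 2 by rewrite divr_gt0.
pose N := [set z | `|y - z| < eps / 2 /\ `|U y - U z| < eps / 2].
have Ny : nbhs y N.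
  apply: filterI; first by have := nbhsx_ballx y _ e2; rewrite -ball_normE.
  by have /(@cvgrPdist_lt _ _ _ (nbhs y)) := cU y; apply.
have [||z [Nz Sz]] := dS (N^°).
- by exists y.
- exact: open_interior.
have [yz Uyz] := interior_subset Nz.
have h1 : `|U y| <= `|U y - U z| + `|U z| by rewrite -{1}(subrK (U z) (U y)) ler_normD.
have h2 : `|z| <= `|y - z| + `|y|.
  by rewrite distrC -{1}(subrK y z) ler_normD.
apply: (le_trans h1); apply: (@le_trans _ _ (eps / 2 + (eps / 2 + `|y|))).
  apply: lerD; first exact: ltW.
  by apply: (le_trans (US _ Sz)); apply: (le_trans h2); rewrite lerD2r ltW.
by rewrite addrA -splitr addrC.
Qed.

Theorem proposition4p2 (R : realType) (q : nat) (hq : (2 <= q)%N)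
    (T : choiceType) (e : rel T) (hT : homogeneous_tree q e) (o : T)
    (lambda : R[i]) (hlambda : ~ spec q e lambda)
    (Y : completeNormedModType R[i]) (iota : (T -> R[i]) -> Y)
    (hY : is_completion (polyharm_space q e o lambda)
            (poly_norm q e o lambda) iota)
    (U : {linear Y -> Y}) (hUcont : continuous U)
    (hU : forall f, polyharm_space q e o lambda f ->
      U (iota f) = iota (shifted q e lambda f)) :
  ~ hypercyclic U.
Proof.
have hl := spec_outer_domain hq o hT hlambda.
have [_ isoN isoD] := hY.
have [f0 Hf0 Nf0] := exists_unit_polyharmonic o hq hT hl.
apply: (@contraction_not_hypercyclic _ _ _ _ (iota f0)); last first.
  by rewrite -normr_eq0 isoN // Nf0 oner_eq0.
(* By density and continuity it is enough to bound [U] on the image of the polyharmonic functions,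
   where [iota] turns the bound into [shifted_contraction]. *)
apply: (dense_contraction hUcont isoD) => _ [f Hf <-].
have [Hsf le] := shifted_contraction hq hT hl Hf.
rewrite hU // !isoN // lecR fine_le ?ge0_fin_numE ?(poly_norm_ge0 hq hT hl) //.
- by case: Hsf.
- by case: Hf.
Qed.
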